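(* Let $\mathbb{K}$ be a field, $d\ge1$, and fix $c$ with $c_d<c<d+1$. Then $$\lim_{n\to\infty}\mathbb{P}\big(Y\in Y_d(n,\tfrac{c}{n}): A_Y\text{ fails the WLP}\big)=1.$$
   Context: $c_1=1$, and for $d>1$, $c_d$ is the unique positive solution of $g_d(x)=d+1$, where $g_d(x)=(d+1)(x+1)e^{-x}+x(1-e^{-x})^{d+1}$ (one has $c_d<d+1$). $Y_d(n,p)$ is the probability space of simplicial complexes $Y$ on vertex set $[n]$ with $\Delta_n^{(d-1)}\subseteq Y\subseteq\Delta_n^{(d)}$, where $\Delta_n^{(k)}$ is the complex of all subsets of $[n]$ of size at most $k+1$, with $\mathbb{P}(Y)=p^{f_d}(1-p)^{\binom{n}{d+1}-f_d}$, $f_d$ the number of $d$-faces of $Y$. $A_Y=\mathbb{K}[x_1,\dots,x_n]/(I_Y+(x_1^{d+2},\dots,x_n^{d+2}))$ with $I_Y$ the Stanley–Reisner ideal of $Y$. An artinian graded algebra $A$ with top nonzero degree $D$ has the weak Lefschetz property (WLP) if there is a linear form $\ell$ with $\times\ell:A_i\to A_{i+1}$ of full rank for all $i<D$. *)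

(* Defs.v *)
From Stdlib Require Import Reals ClassicalEpsilon.
From mathcomp Require Import all_boot all_algebra.
From mathcomp Require Import mpoly.

Unset Printing Implicit Defensive.
Import GRing.Theory.

Definition g_fun (d : nat) (x : R) : R :=
  Rplus (Rmult (Rmult (INR d.+1) (Rplus x R1)) (exp (Ropp x)))
        (Rmult x (pow (Rminus R1 (exp (Ropp x))) d.+1)).

Definition is_c (d : nat) (x : R) : Prop :=
  (d = 1%N /\ x = R1) \/
  (1 < d /\ Rlt R0 x /\ g_fun d x = INR d.+1 /\
   forall y : R, Rlt R0 y -> g_fun d y = INR d.+1 -> y = x).

Section Alg.
Local Open Scope ring_scope.
Variables (K : fieldType) (n : nat).

Definition in_ideal (G : {mpoly K[n]} -> Prop) (f : {mpoly K[n]}) : Prop :=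
  exists s : seq ({mpoly K[n]} * {mpoly K[n]}),
    (forall pr, pr \in s -> G pr.2) /\
    f = \sum_(pr <- s) (pr.1 * pr.2).

(* f is homogeneous of degree i (0 is homogeneous of every degree) *)
Definition is_homog (i : nat) (f : {mpoly K[n]}) : bool :=
  all (fun m : 'X_{1..n} => mdeg m == i) (msupp f).

(* In A = K[x]/I (I generated by G), with A_i the image of the degree-i
   homogeneous polynomials:  A_i = 0. *)
Definition piece_zero (G : {mpoly K[n]} -> Prop) (i : nat) : Prop :=
  forall f, is_homog i f -> in_ideal G f.

Definition top_degree (G : {mpoly K[n]} -> Prop) (D : nat) : Prop :=
  ~ piece_zero G D /\ forall j, (D < j)%N -> piece_zero G j.

Definition mul_inj (G : {mpoly K[n]} -> Prop) (l : {mpoly K[n]}) (i : nat) :=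
  forall f, is_homog i f -> in_ideal G (l * f) -> in_ideal G f.

Definition mul_surj (G : {mpoly K[n]} -> Prop) (l : {mpoly K[n]}) (i : nat) :=
  forall g, is_homog i.+1 g -> exists f, is_homog i f /\ in_ideal G (g - l * f).

(* full rank (rank = min of dimensions) = injective or surjective *)
Definition full_rank (G : {mpoly K[n]} -> Prop) (l : {mpoly K[n]}) (i : nat) :=
  mul_inj G l i \/ mul_surj G l i.

Definition WLP (G : {mpoly K[n]} -> Prop) : Prop :=
  exists l : {mpoly K[n]}, is_homog 1 l /\
    forall D, top_degree G D -> forall i, (i < D)%N -> full_rank G l i.

(* Complexes Y with Delta^{(d-1)} <= Y <= Delta^{(d)} on vertex set [n]
   = 'I_n, encoded by their set F of d-faces (subsets of size d+1).       *)
Definition face_of (d : nat) (F : {set {set 'I_n}}) (s : {set 'I_n}) : bool :=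
  (#|s| <= d)%N || (s \in F).

Definition mono_of (s : {set 'I_n}) : {mpoly K[n]} := \prod_(i in s) 'X_i.

(* generators of I_Y + (x_1^{d+2}, ..., x_n^{d+2}):
   Stanley-Reisner generators x^sigma for non-faces sigma, and x_i^{d+2} *)
Definition gens_AY (d : nat) (F : {set {set 'I_n}}) (g : {mpoly K[n]}) : Prop :=
  (exists s : {set 'I_n}, ~~ face_of d F s /\ g = mono_of s) \/
  (exists i : 'I_n, g = 'X_i ^+ d.+2).

End Alg.

Definition dfaces (n d : nat) (F : {set {set 'I_n}}) : bool :=
  [forall s in F, #|s| == d.+1].

Definition probY (d n : nat) (p : R) (E : {set {set 'I_n}} -> Prop) : R :=
  \big[Rplus/R0]_(F : {set {set 'I_n}} | dfaces n d F)
     (if excluded_middle_informative (E F)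
      then Rmult (pow p #|F|) (pow (Rminus R1 p) ('C(n, d.+1) - #|F|))
      else R0).

(* Main.v *)
Require Import Defs.
From Stdlib Require Import Reals ClassicalEpsilon.
From mathcomp Require Import all_boot all_order all_algebra.
From mathcomp Require Import mpoly Rstruct.
From mathcomp Require Import perm ring lra zify.
Import Order.TTheory GRing.Theory Num.Theory.
Local Open Scope ring_scope.

(* The failure happens in degree i = d(d+3)/2.  Let h_k(j) be the number of compositions
   of j into k parts of size at most d+1.  Monomials of A_Y supported on a (k-1)-face are
   counted by h_k, and the reflection symmetry of h_d gives
   h_{d+1}(i+1) - h_{d+1}(i) = h_d(i) - h_d(i+1) > 0; as h_k is decreasing past its middle,
   dim A_i > dim A_{i+1} as soon as Y has fewer d-faces than (d-1)-faces, so that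
   multiplication by a linear form cannot be injective.  A d-cycle of Y with coefficients
   c_t yields, through the alternants with exponents 1, ..., d+1 on the faces t, a
   functional on A_{i+1} which kills the image of x_1 + ... + x_n; rescaling by the torus
   and degenerating, one gets such a functional for every linear form, so multiplication
   is not surjective either.

   With high probability Y has fewer than C(n,d) d-faces because c < d+1, and it has a
   d-cycle because c > c_d: for d > 1 the nullity of the boundary map is 1-Lipschitz in
   each face, hence concentrated by the Efron-Stein inequality, and its mean is bounded
   below by the mean of (number of d-faces all of whose facets have degree >= 2) minus
   (number of (d-1)-faces of degree >= 2), which is asymptotic to
   (g_d(c) - (d+1)) / (d+1) * C(n,d).  For d = 1, the second moment of the number of
   cycles of a fixed length k shows that the probability of having none is at most about
   k^2 / c^k. *)

(** * Bounded compositions *)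

(** This is h_k(j) of the overview. The index is an integer, so that the count vanishes at negative
    arguments and the reflection and difference formulas hold without side conditions. *)
Fixpoint ncomp (d k : nat) (j : int) : int :=
  if k is k'.+1 then \sum_(e < d.+1) ncomp d k' (j - e.+1%:Z) else (j == 0)%:R.

Lemma ncomp_lt0 d k j : j < 0 -> ncomp d k j = 0.
Proof.
elim: k j => [|k IH] j j0 /=; first by case: eqP => // e; lia.
by rewrite big1 // => e _; apply: IH; lia.
Qed.

(** Replace every part e by d + 2 - e. *)
Lemma ncomp_sym d k j : ncomp d k j = ncomp d k ((k * d.+2)%N%:Z - j).
Proof.
elim: k j => [|k IH] j /=.
  by congr (_%:R); apply/eqP/eqP; lia.
rewrite (reindex_inj rev_ord_inj) /=; apply: eq_bigr => e _.
by rewrite IH; congr ncomp; have := ltn_ord e; lia.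
Qed.

(** Both terms on the left are sums over windows of d + 1 consecutive indices, shifted by one; all
    but the two end terms cancel. *)
Lemma ncomp_diff d k j :
  ncomp d k.+1 (j + 1) - ncomp d k.+1 j = ncomp d k j - ncomp d k (j - d.+1%:Z).
Proof.
rewrite /= -sumrB.
rewrite -[RHS]opprB.
have := telescope_sumr (fun e => ncomp d k (j - e%:Z)) (leq0n d.+1).
rewrite subr0 => <-; rewrite big_mkord -sumrN.
apply: eq_bigr => e _; rewrite opprB; congr (_ - _); congr ncomp; lia.
Qed.

(** The hypotheses say that [j'] lies to the right of [j] and at least as far from the centre
    k(d+2)/2. By [ncomp_diff], one step to the right past the centre for k + 1 parts is an instance
    of the claim for k parts. *)
Lemma ncomp_unimodal d k j j' : j <= j' -> (k * d.+2)%N%:Z <= j + j' ->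
  ncomp d k j' <= ncomp d k j.
Proof.
elim: k j j' => [|k IH] j j' jj' s.
  rewrite /=; case: (j' =P 0) => [e|_]; last by case: eqP.
  by have -> : j = 0 by lia.
have step t : (k.+1 * d.+2)%N%:Z <= 2 * t + 1 ->
    ncomp d k.+1 (t + 1) <= ncomp d k.+1 t.
  move=> ht; rewrite -subr_le0 ncomp_diff subr_le0; apply: IH; lia.
have chain (t : int) (u : nat) : (k.+1 * d.+2)%N%:Z <= 2 * t + 1 ->
    ncomp d k.+1 (t + u%:Z) <= ncomp d k.+1 t.
  move=> ht; elim: u => [|u IHu]; first by rewrite addr0.
  apply: le_trans IHu; have -> : t + u.+1%:Z = t + u%:Z + 1 by lia.
  by apply: step; lia.
case: (lerP (k.+1 * d.+2)%N%:Z (2 * j + 1)) => h.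
  have -> : j' = j + `|j' - j|%N%:Z by lia.
  exact: chain.
(* Here [j] is left of the centre; its mirror image is right of it and still at most [j']. *)
rewrite (ncomp_sym _ _ j).
have [r er] : {r | r = (k.+1 * d.+2)%N%:Z - j} by exists ((k.+1 * d.+2)%N%:Z - j).
rewrite -er; have -> : j' = r + `|j' - r|%N%:Z by lia.
by apply: chain; lia.
Qed.

Lemma ncomp1 d j : ncomp d 1 j = ((1 <= j) && (j <= d.+1%:Z))%:R.
Proof.
rewrite /=; case: (boolP (_ && _)) => h.
  have jd : (`|j|%N.-1 < d.+1)%N by lia.
  rewrite (bigD1 (Ordinal jd)) //= big1 => [|e].
    by rewrite addr0; case: eqP => //; lia.
  by rewrite -val_eqE /= => /eqP; case: eqP => //; lia.
by rewrite big1 // => e _; have := ltn_ord e; case: eqP => //; lia.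
Qed.

(** The upper bound k(d+1) on [j] is the last index with a nonzero count. At least two parts are
    required because for one part the count is constant on its range. *)
Lemma ncomp_strict d k j : (1 < k)%N -> (k * d.+2)%N%:Z <= 2 * j ->
  j <= (k * d.+1)%N%:Z -> ncomp d k (j + 1) < ncomp d k j.
Proof.
case: k => // k; rewrite ltnS; elim: k j => // k IH j _ jl jr.
rewrite -subr_lt0 ncomp_diff subr_lt0.
case: k IH jl jr => [|k] IH jl jr.
  have -> : ncomp d 1 j = 0 by rewrite ncomp1; case: (boolP (_ && _)) => //; lia.
  by rewrite ncomp1; case: (boolP (_ && _)) => //; lia.
(* From [r] past the centre, one strict step by induction and then [ncomp_unimodal] lead to [j]. The
   point [r] will be j - d - 1 or its mirror image, whichever is past the centre. *)
have main (r : int) : (k.+2 * d.+2)%N%:Z <= 2 * r -> r < j -> r <= (k.+2 * d.+1)%N%:Z ->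
    ncomp d k.+2 j < ncomp d k.+2 r.
  move=> h1 h2 h3; apply: le_lt_trans (IH r isT h1 h3).
  apply: ncomp_unimodal; lia.
case: (lerP (k.+2 * d.+2)%N%:Z (2 * (j - d.+1%:Z))) => h; first by apply: main; lia.
by rewrite (ncomp_sym _ _ (_ - _)); apply: main; lia.
Qed.

Lemma ncomp_middle d : (0 < d)%N ->
  ncomp d d ((d * d.+3)./2%:Z + 1) < ncomp d d (d * d.+3)./2%:Z.
Proof.
have e2 : ((d * d.+3)./2.*2 = d * d.+3)%N.
  by rewrite even_halfK // oddM /=; case: (odd d).
(* For d = 1 there is a single part, and i = 2 is the last index with a nonzero count. *)
case: d e2 => // [[|d]] e2 _; first by rewrite !ncomp1.
by apply: ncomp_strict => //; nia.
Qed.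

(** * Standard monomials and their number *)

Definition supp (n : nat) (m : 'X_{1..n}) : {set 'I_n} := [set x | m x != 0%N].

Definition standard (n d : nat) (F : {set {set 'I_n}}) (m : 'X_{1..n}) : bool :=
  [forall x, m x <= d.+1]%N && face_of n d F (supp n m).

Lemma face_of_sub (n d : nat) (F : {set {set 'I_n}}) (s t : {set 'I_n}) :
  dfaces n d F -> s \subset t -> face_of n d F t -> face_of n d F s.
Proof.
move=> /forall_inP dF st /orP[td|tF]; rewrite /face_of.
  by rewrite (leq_trans (subset_leq_card st) td).
case: (eqVneq s t) => [->|nst]; first by rewrite tF orbT.
have := proper_card (_ : s \proper t); rewrite properEneq nst st => /(_ isT).
by rewrite (eqP (dF _ tF)) ltnS => ->.
Qed.

Lemma standard_sub (n d : nat) (F : {set {set 'I_n}}) (k m : 'X_{1..n}) :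
  dfaces n d F -> (k <= m)%MM -> standard n d F m -> standard n d F k.
Proof.
move=> dF /mnm_lepP km /andP[/forallP m1 m2]; apply/andP; split.
  by apply/forallP=> x; apply: leq_trans (km x) (m1 x).
apply: face_of_sub dF _ m2; apply/subsetP => x; rewrite !inE.
by apply: contra => /eqP mx; have := km x; rewrite mx leqn0.
Qed.

Lemma mono_ofE (K : fieldType) (n : nat) (s : {set 'I_n}) :
  mono_of K n s = 'X_[[multinom ((x \in s) : nat) | x < n]].
Proof.
rewrite /mono_of mprodXE; congr 'X_[_]; apply/mnmP => x.
rewrite mnm_sumE mnmE; have [xs|xs] := boolP (x \in s).
  rewrite (bigD1 x) //= mnm1E eqxx big1 ?addn0 // => y /andP[_ /negbTE yx].
  by rewrite mnm1E yx.
by rewrite big1 // => y ys; rewrite mnm1E; case: eqP xs => // <-; rewrite ys.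
Qed.

Lemma gens_AY_monomial (K : fieldType) (n d : nat) (F : {set {set 'I_n}}) g :
  gens_AY K n d F g -> exists2 k, ~~ standard n d F k & g = 'X_[k].
Proof.
case=> [[s [nf ->]]|[i ->]].
  rewrite mono_ofE; eexists; last by [].
  apply: contra nf => /andP[_]; congr (face_of _ _ _ _).
  by apply/setP => x; rewrite inE mnmE; case: (x \in s).
exists (U_(i) *+ d.+2)%MM; last by rewrite mpolyXn.
apply/negP => /andP[/forallP /(_ i)].
by rewrite mulmnE mnm1E eqxx mul1n ltnn.
Qed.

Lemma nonstandard_gens (K : fieldType) (n d : nat) (F : {set {set 'I_n}}) m :
  ~~ standard n d F m ->
  exists k g, gens_AY K n d F g /\ 'X_[m] = 'X_[k] * g.
Proof.
rewrite negb_and negb_forall => /orP[/existsP[x]|nf].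
  rewrite -ltnNge => mx; exists (m - U_(x) *+ d.+2)%MM, ('X_x ^+ d.+2).
  split; first by right; exists x.
  rewrite mpolyXn -mpolyXD submK //; apply/mnm_lepP => y.
  by rewrite mulmnE mnm1E; case: eqP => [<-|]; rewrite ?mul1n ?mul0n.
exists (m - [multinom ((x \in supp n m) : nat) | x < n])%MM, (mono_of K n (supp n m)).
split; first by left; exists (supp n m).
rewrite mono_ofE -mpolyXD submK //; apply/mnm_lepP => y.
by rewrite mnmE inE; case: (m y) => [|j]; rewrite ?eqxx.
Qed.

Lemma mcoeffMX_eq0 (K : fieldType) (n : nat) (p : {mpoly K[n]}) (k m : 'X_{1..n}) :
  ~~ (k <= m)%MM -> (p * 'X_[k])@_m = 0.
Proof.
move=> km; apply: memN_msupp_eq0; rewrite (perm_mem (msuppMX _ _)).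
apply: contra km => /mapP[m' _ ->]; apply: lem_addr; exact: lepm_refl.
Qed.

(** The ideal is generated by nonstandard monomials, and standardness passes to divisors, so the
    standard monomials form a basis of the quotient. All later statements on A_Y go through this
    test on coefficients. *)
Lemma in_ideal_AYP (K : fieldType) (n d : nat) (F : {set {set 'I_n}})
    (f : {mpoly K[n]}) : dfaces n d F ->
  in_ideal K n (gens_AY K n d F) f <-> forall m, standard n d F m -> f@_m = 0.
Proof.
move=> dF; split.
  case=> s [sG ->] m stm; rewrite raddf_sum /= big_seq big1 // => pr prs.
  have [k nk ->] := gens_AY_monomial _ _ _ _ _ (sG _ prs).
  by apply: mcoeffMX_eq0; apply: contra nk => km; apply: standard_sub km stm.
move=> f0; rewrite [f]mpolyE big_seq.
apply: (big_ind (in_ideal K n (gens_AY K n d F))).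
- by exists [::]; rewrite big_nil.
- move=> _ _ [s [sG ->]] [t [tG ->]]; exists (s ++ t); rewrite big_cat; split=> //.
  by move=> pr; rewrite mem_cat => /orP[/sG|/tG].
- move=> m mf; have nstd : ~~ standard n d F m.
    by apply/negP => /f0 /eqP; rewrite mcoeff_eq0 mf.
  have [k [g [gG ->]]] := nonstandard_gens K _ _ _ _ nstd.
  exists [:: (f@_m *: 'X_[k], g)]; rewrite big_seq1 scalerAl; split=> //.
  by move=> pr; rewrite inE => /eqP ->.
Qed.

Lemma is_homogP (K : fieldType) (n i : nat) (f : {mpoly K[n]}) :
  reflect (forall m, mdeg m != i -> f@_m = 0) (is_homog K n i f).
Proof.
apply: (iffP allP) => h m.
  by move=> mi; apply: memN_msupp_eq0; apply: contra mi => /h.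
by rewrite mcoeff_msupp; apply: contraR => /h ->.
Qed.

Lemma linear_form_sum (K : fieldType) (n : nat) (l : {mpoly K[n]}) :
  is_homog K n 1 l -> l = \sum_v l@_U_(v) *: 'X_v.
Proof.
move=> /is_homogP l1; apply/mpolyP => m; rewrite raddf_sum /=.
have [/mdeg1P[v /eqP ->]|m1] := boolP (mdeg m == 1%N).
  rewrite (bigD1 v) //= mcoeffZ mcoeffXU eqxx mulr1 big1 ?addr0 // => w /negbTE wv.
  by rewrite mcoeffZ mcoeffXU wv mulr0.
rewrite l1 // big1 // => v _; rewrite mcoeffZ mcoeffX.
by case: (U_(v)%MM =P m) m1 => [<-|]; rewrite ?mdeg1 ?mulr0.
Qed.

Lemma linear_form_mulX (K : fieldType) (n : nat) (l : {mpoly K[n]}) m :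
  is_homog K n 1 l -> l * 'X_[m] = \sum_v l@_U_(v) *: 'X_[m + U_(v)].
Proof.
move=> l1; rewrite {1}(linear_form_sum _ _ _ l1) mulr_suml; apply: eq_bigr => v _.
by rewrite -scalerAl -mpolyXD addmC.
Qed.

(** * Counting standard monomials of a given degree *)

(** Exponents are taken in ['I_d.+2] to obtain a finite type, whose subsets can be counted and can
    index the rows and columns of a matrix. *)
Definition monoset (n d : nat) (F : {set {set 'I_n}}) (j : nat) :
    {set {ffun 'I_n -> 'I_d.+2}} :=
  [set e : {ffun 'I_n -> 'I_d.+2} |
    face_of n d F [set x | e x != 0%N :> nat] & \sum_x e x == j :> nat]%N.

Definition mono_exp (n d : nat) (e : {ffun 'I_n -> 'I_d.+2}) : 'X_{1..n} :=
  [multinom (e x : nat) | x < n].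

Lemma mono_exp_inj (n d : nat) : injective (mono_exp n d).
Proof.
move=> e e' /mnmP ee; apply/ffunP => x; apply: val_inj.
by have := ee x; rewrite !mnmE.
Qed.

Lemma mono_expP (n d : nat) (F : {set {set 'I_n}}) (m : 'X_{1..n}) j :
  reflect (exists2 e, e \in monoset n d F j & m = mono_exp n d e)
          (standard n d F m && (mdeg m == j)).
Proof.
apply: (iffP andP) => [[/andP[/forallP m1 m2] /eqP mj]|[e]].
  pose e := [ffun x => inord (m x)] : {ffun 'I_n -> 'I_d.+2}.
  have eE x : e x = m x :> nat by rewrite ffunE inordK // ltnS.
  exists e; last by apply/mnmP => x; rewrite mnmE eE.
  rewrite inE; apply/andP; split.
    by move: m2; congr (face_of _ _ _ _); apply/setP => x; rewrite !inE eE.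
  by rewrite -mj mdegE; apply/eqP; apply: eq_bigr => x _; rewrite eE.
rewrite inE => /andP[e1 /eqP e2] ->; split; last first.
  by rewrite mdegE -e2; apply/eqP; apply: eq_bigr => x _; rewrite mnmE.
apply/andP; split; first by apply/forallP => x; rewrite mnmE -ltnS.
by move: e1; congr (face_of _ _ _ _); apply/setP => x; rewrite !inE mnmE.
Qed.

(** If the target had fewer standard monomials, the matrix [A] of multiplication by [l] in the
    monomial bases would have a nonzero row vector in its left kernel, that is, a nonzero element of
    A_i killed by [l]. *)
Lemma mul_inj_card (K : fieldType) (n d : nat) (F : {set {set 'I_n}})
    (l : {mpoly K[n]}) (i : nat) : dfaces n d F -> is_homog K n 1 l ->
  mul_inj K n (gens_AY K n d F) l i ->
  (#|monoset n d F i| <= #|monoset n d F i.+1|)%N.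
Proof.
move=> dF l1 inj; rewrite leqNgt; apply/negP => lt.
pose A := \matrix_(r < #|monoset n d F i|, s < #|monoset n d F i.+1|)
  (l * 'X_[mono_exp n d (enum_val r)])@_(mono_exp n d (enum_val s)).
have : kermx A != 0.
  rewrite kermx_eq0 /row_free neq_ltn (leq_ltn_trans (rank_leq_col A)) //.
case/rowV0Pn => w; rewrite sub_kermx => /eqP wA /negP; apply; apply/eqP.
pose f := \sum_r w 0 r *: 'X_[mono_exp n d (enum_val r)].
have monoE j e : e \in monoset n d F j ->
    standard n d F (mono_exp n d e) /\ mdeg (mono_exp n d e) = j.
  move=> eB; have : standard n d F (mono_exp n d e) && (mdeg (mono_exp n d e) == j).
    by apply/mono_expP; exists e.
  by case/andP => -> /eqP ->.
have degE j e : e \in monoset n d F j -> mdeg (mono_exp n d e) = j.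
  by case/monoE.
have fi : is_homog K n i f.
  apply/is_homogP => m mi; rewrite raddf_sum big1 //= => r _.
  by rewrite mcoeffZ mcoeffX; case: (_ =P m) mi => [<-|_ _]; rewrite ?mulr0 // (degE i) ?enum_valP // eqxx.
have lf : in_ideal K n (gens_AY K n d F) (l * f).
  apply/in_ideal_AYP => // m stm; rewrite /f mulr_sumr raddf_sum /=.
  have [mi|mi] := boolP (mdeg m == i.+1).
    have /mono_expP[e eB ->] : standard n d F m && (mdeg m == i.+1) by rewrite stm.
    have := congr1 (fun M : 'rV_ _ => M 0 (enum_rank_in eB e)) wA.
    rewrite !mxE => {2}<-; apply: eq_bigr => r _.
    by rewrite mxE enum_rankK_in // -scalerAr mcoeffZ.
  rewrite big1 // => r _; rewrite -scalerAr mcoeffZ linear_form_mulX //.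
  rewrite raddf_sum /= big1 ?mulr0 // => v _; rewrite mcoeffZ mcoeffX.
  by case: (_ =P m) mi => [<-|_ _]; rewrite ?mulr0 // mdegD mdeg1 (degE i) ?enum_valP // addn1 eqxx.
have := inj f fi lf; move/in_ideal_AYP => /(_ dF) f0.
apply/rowP => r; rewrite mxE.
have /f0 : standard n d F (mono_exp n d (enum_val r)).
  by have [] := monoE i _ (enum_valP r).
rewrite raddf_sum /= (bigD1 r) //= mcoeffZ mcoeffX eqxx mulr1 big1 ?addr0 //.
move=> r' /negbTE rr; rewrite mcoeffZ mcoeffX; case: eqP; rewrite ?mulr0 //.
by move/mono_exp_inj/enum_val_inj/eqP; rewrite rr.
Qed.

Lemma coef_compositions (d k j : nat) :
  ((\sum_(t < d.+1) 'X^(t.+1) : {poly int}) ^+ k)`_j = ncomp d k j.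
Proof.
elim: k j => [|k IH] j; first by rewrite expr0 coef1.
rewrite exprS mulr_suml coef_sum /=; apply: eq_bigr => t _.
rewrite coefXnM; case: ltnP => h; last by rewrite IH; congr ncomp; lia.
by rewrite ncomp_lt0 //; lia.
Qed.

(** Generating function: expand a product of one polynomial per variable, equal to X + ... + X^(d+1)
    for a variable in [s] and to 1 for the others. *)
Lemma card_exponents (n d j : nat) (s : {set 'I_n}) :
  #|[set e : {ffun 'I_n -> 'I_d.+2} |
     [set x | e x != 0%N :> nat] == s & \sum_x e x == j :> nat]%N|%:Z =
  ncomp d #|s| j.
Proof.
pose G x (t : 'I_d.+2) : {poly int} := ((t != 0%N :> nat) == (x \in s))%:R * 'X^t.
have GE x : \sum_t G x t = if x \in s then \sum_(t < d.+1) 'X^(t.+1) else 1.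
  rewrite big_ord_recl /G /= expr0 mulr1; case: (x \in s).
    by rewrite add0r; apply: eq_bigr => t _; rewrite mul1r.
  by rewrite big1 ?addr0 // => t _; rewrite mul0r.
rewrite -coef_compositions.
have -> : (\sum_(t < d.+1) 'X^(t.+1) : {poly int}) ^+ #|s| = \prod_x \sum_t G x t.
  rewrite -prodr_const big_mkcond /=; apply: eq_bigr => x _.
  by rewrite GE.
rewrite bigA_distr_bigA coef_sum -sum1_card -natz natr_sum big_mkcond /=; apply: eq_bigr => e _; rewrite inE.
have -> : \prod_x G x (e x) =
    ([set x | e x != 0%N :> nat] == s)%:R * 'X^(\sum_x e x)%N.
  rewrite big_split /= -prodrXr; congr (_ * _).
  have [/eqP es|es] := boolP (_ == s).
    by rewrite big1 // => x _; rewrite -es inE eqxx.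
  have [x hx] : exists x, (e x != 0%N :> nat) != (x \in s).
    apply/existsP; apply: contraR es; rewrite negb_exists => /forallP h.
    by apply/eqP/setP => x; rewrite inE; move: (h x); rewrite negbK => /eqP.
  by rewrite (bigD1 x) //= (negbTE hx) mul0r.
case: (_ == s); rewrite ?mul1r ?mul0r ?coef0 //= coefXn eq_sym.
by case: (j == _).
Qed.

Lemma card_monoset (n d : nat) (F : {set {set 'I_n}}) (j : nat) :
  #|monoset n d F j|%:Z = \sum_(s | face_of n d F s) ncomp d #|s| j.
Proof.
rewrite -sum1_card.
rewrite (partition_big (fun e : {ffun 'I_n -> 'I_d.+2} => [set x | e x != 0%N :> nat])
   (face_of n d F)) /=; last by move=> e; rewrite inE => /andP[].
rewrite -natz natr_sum; apply: eq_bigr => s fs; rewrite -card_exponents.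
rewrite -sum1_card natz; congr Posz; apply: eq_bigl => e; rewrite !inE.
by case: ([set x | _] =P s) => [->|]; rewrite ?andbF // fs andbT.
Qed.

(** Group the monomials by support. Supports of fewer than d vertices contribute a nonnegative
    amount to dim A_i - dim A_(i+1), each of the C(n, d) supports of size d contributes [D d] > 0,
    and each d-face contributes - [D d]. *)
Lemma card_monoset_gt (n d : nat) (F : {set {set 'I_n}}) : (0 < d)%N ->
  dfaces n d F -> (#|F| < 'C(n, d))%N ->
  (#|monoset n d F (d * d.+3)./2.+1| < #|monoset n d F (d * d.+3)./2|)%N.
Proof.
move=> d0 dF Fn; set i := (d * d.+3)./2.
have i2 : (i.*2 = d * d.+3)%N by rewrite even_halfK // oddM /=; case: (odd d).
rewrite -ltz_nat -subr_gt0 !card_monoset -sumrB /=.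
pose D k : int := ncomp d k i - ncomp d k (i.+1%:Z).
have Dge k : (k <= d)%N -> 0 <= D k.
  by move=> kd; rewrite subr_ge0; apply: ncomp_unimodal; nia.
have iS : i.+1%:Z = i%:Z + 1 by lia.
have Dd : 0 < D d by rewrite subr_gt0 iS ncomp_middle.
(* The symmetry of [ncomp d d] identifies the two jumps at the middle degree. *)
have DS : D d.+1 = - D d.
  rewrite /D -[LHS]opprB iS ncomp_diff -iS; congr (- (_ - _)).
  by rewrite ncomp_sym; congr ncomp; nia.
have -> : \sum_(s | face_of n d F s) (ncomp d #|s| i - ncomp d #|s| i.+1) =
  \sum_(s : {set 'I_n} | (#|s| < d)%N) D #|s| +
  (\sum_(s : {set 'I_n} | #|s| == d) D #|s| + \sum_(s in F) D #|s|).
  rewrite (bigID (fun s : {set 'I_n} => #|s| < d)%N) /=; congr (_ + _).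
    by apply: eq_bigl => s; rewrite /face_of; case: ltngtP; rewrite ?andbT ?andbF ?orbF.
  rewrite (bigID (fun s : {set 'I_n} => #|s| == d)%N) /=; congr (_ + _).
    by apply: eq_bigl => s; rewrite /face_of; case: ltngtP; rewrite ?andbT ?andbF.
  apply: eq_bigl => s; rewrite /face_of; case: ltngtP; rewrite ?andbT ?andbF //=.
  - move=> sd; apply/esym; apply: contraTF sd => /(forall_inP dF) /eqP ->.
    by rewrite -leqNgt.
  - move=> sd; apply/esym; apply: contra_eqF sd => /(forall_inP dF) /eqP ->.
    by rewrite neq_ltn ltnSn orbT.
apply: ltr_wpDl; first by apply: sumr_ge0 => s /ltnW /Dge.
rewrite (eq_bigr (fun=> D d)); last by move=> s /eqP ->.
rewrite [X in _ + X](eq_bigr (fun=> - D d)); last first.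
  by move=> s /(forall_inP dF) /eqP ->.
have -> : \sum_(s : {set 'I_n} | #|s| == d) D d = D d *+ 'C(n, d).
  rewrite sumr_const -[in RHS](card_ord n) -card_draws; congr (_ *+ _).
  by apply: eq_card => s; rewrite inE.
by rewrite sumr_const mulNrn -mulrnBr ?(ltnW Fn) // pmulrn_lgt0 // subn_gt0.
Qed.

(** * Alternants and the failure of surjectivity *)

(** For [v] outside [s] this is the position of [v] in the ordered simplex [v |: s], so its parity
    gives the sign of the facet [s] in the simplicial boundary. *)
Definition incidence_sign (n : nat) (s : {set 'I_n}) (v : 'I_n) : nat :=
  #|[set u in s | (u < v)%N]|.

(** A nonzero simplicial cycle over [K] supported on [F]. The boundary condition ranges over all
    vertex sets; when [F] consists of d-faces it is automatic for sets not of size d. *)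
Definition has_cycle (K : fieldType) (n : nat) (F : {set {set 'I_n}}) : Prop :=
  exists c : {set 'I_n} -> K,
    [/\ exists t, c t != 0, forall t, c t != 0 -> t \in F &
      forall s : {set 'I_n}, \sum_(v | v \notin s) (-1) ^+ incidence_sign n s v * c (v |: s) = 0].

(** The exponents on the support are 1, ..., d + 1 in some order: these are the monomials occurring
    in the alternants. *)
Definition staircase (n d : nat) (m : 'X_{1..n}) : bool :=
  [&& #|supp n m| == d.+1, [forall x, m x <= d.+1]%N &
   [forall x, forall y, (m x != 0%N) ==> (m x == m y) ==> (x == y)]].

(** Variables outside the support are excluded, so for a staircase monomial these are the inversions
    of the permutation formed by its exponents. *)
Definition inversions (n : nat) (m : 'X_{1..n}) : {set 'I_n * 'I_n} :=
  [set q : 'I_n * 'I_n | (q.1 < q.2) && (0 < m q.2 < m q.1)]%N.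

(* The coefficients of [\sum_t c t V_t], where [V_t] is the Vandermonde-like
   alternant with exponents 1, ..., d+1 in the variables of [t]. *)
Definition alternant (K : fieldType) (n d : nat) (c : {set 'I_n} -> K)
    (m : 'X_{1..n}) : K :=
  if staircase n d m then (-1) ^+ #|inversions n m| * c (supp n m) else 0.

Lemma staircaseP (n d : nat) (m : 'X_{1..n}) :
  reflect [/\ #|supp n m| = d.+1, forall x, (m x <= d.+1)%N &
     forall x y, m x != 0%N -> m x = m y -> x = y] (staircase n d m).
Proof.
apply: (iffP and3P) => [[/eqP h1 /forallP h2 /forallP h3]|[h1 h2 h3]]; split=> //.
- move=> x y m0 mxy; apply/eqP; move/forallP/(_ y): (h3 x).
  by rewrite m0 mxy eqxx.
- by rewrite h1.
- exact/forallP.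
- by do 2![apply/forallP => ?]; do 2!apply/implyP => ?; apply/eqP/h3 => //; apply/eqP.
Qed.

Lemma staircase_values (n d : nat) (m : 'X_{1..n}) : staircase n d m ->
  [set inord (m x) | x in supp n m] = [set~ ord0 : 'I_d.+2].
Proof.
case/staircaseP => h1 h2 h3; apply/eqP; rewrite eqEcard; apply/andP; split.
  apply/subsetP => _ /imsetP[x xm ->]; rewrite !inE -val_eqE /= inordK ?ltnS //.
  by rewrite inE in xm.
rewrite cardsC1 card_ord card_in_imset ?h1 // => x y; rewrite !inE => x0 y0.
by move/(congr1 val); rewrite /= !inordK ?ltnS // => /h3 ->.
Qed.

Lemma staircase_surj (n d : nat) (m : 'X_{1..n}) (e : nat) : staircase n d m ->
  (0 < e <= d.+1)%N -> exists x, m x = e.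
Proof.
move=> sm /andP[e0 ed]; have := staircase_values _ _ _ sm.
move/setP/(_ (inord e)); rewrite !inE -val_eqE /= inordK ?ltnS // -lt0n e0.
case/imsetP => x xm /(congr1 val); case/staircaseP: sm => _ h _.
by rewrite /= !inordK ?ltnS // => ->; exists x.
Qed.

Lemma staircase_mdeg (n d : nat) (m : 'X_{1..n}) : staircase n d m ->
  mdeg m = (d * d.+3)./2.+1.
Proof.
move=> sm; rewrite mdegE (bigID (mem (supp n m))) /= [X in (_ + X)%N]big1 ?addn0; last first.
  by move=> x; rewrite inE negbK => /eqP.
have := staircase_values _ _ _ sm; case/staircaseP: (sm) => _ h2 h3 vals.
transitivity (\sum_(e in [set~ ord0 : 'I_d.+2]) e)%N.
  rewrite -vals big_imset /=; last first.
    move=> x y; rewrite !inE => x0 y0.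
    by move/(congr1 val); rewrite /= !inordK ?ltnS // => /h3 ->.
  by apply: eq_bigr => x _; rewrite inordK // ltnS.
transitivity (\sum_(e < d.+2) e)%N.
  by rewrite [RHS](bigD1 ord0) //=; apply: eq_bigl => e; rewrite !inE.
rewrite -(big_mkord xpredT (fun e => e)) bin2_sum bin2.
have -> : (d.+2 * d.+2.-1 = d * d.+3 + 1.*2)%N by rewrite /=; nia.
by rewrite halfD doubleK odd_double andbF addn1.
Qed.

Lemma staircase_swap (n d : nat) (m : 'X_{1..n}) (u w : 'I_n) :
  m u = m w -> m u != 0%N ->
  staircase n d (m + U_(u))%MM -> staircase n d (m + U_(w))%MM.
Proof.
move=> muw mu0 /staircaseP[h1 h2 h3].
have tE x : (m + U_(w))%MM x = (m + U_(u))%MM (tperm u w x).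
  rewrite !mnmDE !mnm1E; case: tpermP => [->|->|/eqP xu /eqP xw].
  - by rewrite muw [u == w]eq_sym.
  - by rewrite muw !eqxx.
  - by rewrite [w == x]eq_sym [u == x]eq_sym (negbTE xu) (negbTE xw).
apply/staircaseP; split.
- rewrite -h1; apply: eq_card => x; rewrite !inE !mnmDE !mnm1E.
  by case: (u =P x) => [<-|_]; case: (w =P _) => [<-|_]; lia.
- by move=> x; rewrite tE.
- by move=> x y; rewrite !tE => x0 /(h3 _ _ x0) /perm_inj.
Qed.

(** The exponents of [u] and [w] are consecutive integers, and no other variable has either of them;
    exchanging them affects no pair but (u, w). *)
Lemma inversions_swap (n d : nat) (m : 'X_{1..n}) (u w : 'I_n) :
  (u < w)%N -> m u = m w -> m u != 0%N -> staircase n d (m + U_(u))%MM ->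
  #|inversions n (m + U_(u))%MM| = #|inversions n (m + U_(w))%MM|.+1.
Proof.
move=> uw muw mu0 /staircaseP[h1 h2 h3].
have u_w : (u == w) = false by apply/eqP => e; rewrite e ltnn in uw.
have w_u : (w == u) = false by rewrite eq_sym.
have far x : x != u -> x != w -> m x != m u /\ m x != (m u).+1.
  move=> xu xw; have xs k : m x = k.+1 -> (m + U_(u))%MM x = k.+1.
    by rewrite mnmDE mnm1E eq_sym (negbTE xu) addn0.
  split; apply/eqP => mx.
    case E: (m u) mu0 => [//|k] _; have := h3 x w.
    rewrite !mnmDE !mnm1E [u == x]eq_sym (negbTE xu) -muw mx E.
    rewrite u_w; by move=> /(_ isT erefl) /eqP; rewrite (negbTE xw).
  have := h3 x u; rewrite !mnmDE !mnm1E eqxx [u == x]eq_sym (negbTE xu) mx addn0 addn1.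
  by move=> /(_ isT erefl) /eqP; rewrite (negbTE xu).
have -> : inversions n (m + U_(u))%MM = (u, w) |: inversions n (m + U_(w))%MM.
  apply/setP => -[x y]; rewrite !inE /= !mnmDE !mnm1E xpair_eqE.
  have := far x; have := far y.
  case: (eqVneq x u) => [?|xu]; [subst x|case: (eqVneq x w) => [?|xw]; [subst x|]];
  (case: (eqVneq y u) => [?|yu]; [subst y|case: (eqVneq y w) => [?|yw]; [subst y|]]);
  rewrite ?eqxx ?u_w ?w_u /=; lia.
rewrite cardsU1 inE /= !mnmDE !mnm1E !eqxx ?u_w ?w_u -muw; lia.
Qed.

(** The sum collects the alternant coefficients of all multiples of [m] by one variable. If two
    variables of [m] share a nonzero exponent, only these two can be raised, and the results have
    opposite signs. Otherwise only variables outside the support contribute, and they reproduce the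
    boundary of [c] at the support of [m]. *)
Lemma alternant_sum (K : fieldType) (n d : nat) (c : {set 'I_n} -> K) m :
  (forall s : {set 'I_n}, \sum_(v | v \notin s) (-1) ^+ incidence_sign n s v * c (v |: s) = 0) ->
  \sum_v alternant K n d c (m + U_(v))%MM = 0.
Proof.
move=> cyc.
have [/existsP[u /existsP[w /and3P[uw /eqP muw mu0]]]|nrep] :=
  boolP [exists u : 'I_n, exists w : 'I_n, [&& (u < w)%N, m u == m w & m u != 0%N]].
  have uw' : u != w by rewrite neq_ltn uw.
  rewrite (bigD1 u) //= (bigD1 w) /=; last by rewrite eq_sym.
  rewrite addrA big1 ?addr0; last first.
    move=> v /andP[vu vw]; rewrite /alternant; case: ifP => // /staircaseP[_ _ h].
    case/eqP: uw'; apply: h; rewrite !mnmDE !mnm1E (negbTE vu) ?(negbTE vw) addn0 //.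
    by rewrite muw addn0.
  have suppE v : m v != 0%N -> supp n (m + U_(v))%MM = supp n m.
    move=> v0; apply/setP => x; rewrite !inE mnmDE mnm1E.
    by case: (v =P x) v0 => [<-|]; rewrite ?addn0 // addn1.
  rewrite /alternant.
  have -> : staircase n d (m + U_(w))%MM = staircase n d (m + U_(u))%MM.
    by apply/idP/idP; apply: staircase_swap; rewrite -?muw.
  case: ifP => su; last by rewrite addr0.
  rewrite (inversions_swap n d m u w) // !suppE -?muw //.
  by rewrite exprS mulN1r mulNr addNr.
have rep u w : m u != 0%N -> m u = m w -> u = w.
  move=> mu0 muw; apply: contraNeq nrep => nuw.
  case: (ltngtP u w) => [uw|wu|/val_inj/eqP]; last by rewrite (negbTE nuw).
    by apply/existsP; exists u; apply/existsP; exists w; rewrite uw muw eqxx -muw.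
  by apply/existsP; exists w; apply/existsP; exists u; rewrite wu muw eqxx -muw.
rewrite (bigID (mem (supp n m))) /= big1 ?add0r; last first.
  move=> v; rewrite inE => mv0; rewrite /alternant; case: ifP => // sv.
  (* Raising a variable of the support leaves the value [m v] unattained, as no other variable has
     that exponent. *)
  have [|w wE] := staircase_surj _ _ _ (m v) sv.
    rewrite lt0n mv0 /=; case/staircaseP: sv => _ /(_ v) + _.
    by rewrite mnmDE mnm1E eqxx; lia.
  move: wE; rewrite mnmDE mnm1E; case: (v =P w) => [<-|vw]; first by lia.
  by rewrite addn0 => /esym /(rep _ _ mv0).
have [/existsP[v0 /andP[v0m sv0]]|none] :=
    boolP [exists v, (v \notin supp n m) && staircase n d (m + U_(v))%MM]; last first.
  rewrite big1 // => v vm; rewrite /alternant ifN //.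
  by apply: contra none => sv; apply/existsP; exists v; rewrite vm.
have suppE v : supp n (m + U_(v))%MM = v |: supp n m.
  apply/setP => x; rewrite !inE mnmDE mnm1E.
  by case: (eqVneq x v) => _ /=; rewrite ?addn0 // addn1.
case/staircaseP: sv0 => h1 h2 h3.
(* In m + U_(v0) the exponent 1 belongs to [v0], so [m] itself takes the values 2, ..., d + 1, and
   every vertex outside its support can receive the missing 1. *)
have n1 x : m x != 1%N.
  apply/eqP => mx; have := h3 x v0; move: v0m; rewrite inE negbK => /eqP m0.
  rewrite !mnmDE !mnm1E eqxx m0; case: (v0 =P x) => [e|]; first by rewrite -e m0 in mx.
  by move=> ne; rewrite mx => /(_ isT erefl) /esym.
have st v : v \notin supp n m -> staircase n d (m + U_(v))%MM.
  move=> vm; have m0 : m v = 0%N by apply/eqP; rewrite inE negbK in vm.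
  apply/staircaseP; split.
  - by rewrite -h1 !suppE !cardsU1 vm v0m.
  - move=> x; rewrite mnmDE mnm1E; case: (v =P x) => [<-|_]; first by rewrite m0.
    by rewrite addn0; apply: leq_trans (h2 x); rewrite mnmDE leq_addr.
  - move=> x y; rewrite !mnmDE !mnm1E; case: (v =P x) => [<-|_]; case: (v =P y) => [<-|_] //.
    + by rewrite m0 addn0 => _ my; have := n1 y; rewrite -my.
    + by rewrite m0 addn0 => _ mx; have := n1 x; rewrite mx.
    + by rewrite !addn0; apply: rep.
(* The new exponent 1 is the smallest, so [v] forms inversions exactly with the support vertices
   before it: the sign of the permutation picks up the incidence sign. *)
have invE v : v \notin supp n m -> #|inversions n (m + U_(v))%MM| =
    (#|inversions n m| + incidence_sign n (supp n m) v)%N.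
  move=> vm; have m0 : m v = 0%N by apply/eqP; rewrite inE negbK in vm.
  have -> : inversions n (m + U_(v))%MM =
     inversions n m :|: [set (u, v) | u in [set u in supp n m | (u < v)%N]].
    apply/setP => -[x y]; rewrite !inE /= !mnmDE !mnm1E.
    have -> : ((x, y) \in [set (u, v) | u in [set u in supp n m | (u < v)%N]]) =
       [&& y == v, m x != 0%N & (x < v)%N].
      apply/imsetP/idP => [[u + [-> ->]]|/and3P[/eqP -> x0 xv]].
        by rewrite !inE eqxx.
      by exists x; rewrite ?inE ?x0.
    have := n1 x; rewrite ![v == _]eq_sym.
    by case: (x =P v) => [->|]; case: (y =P v) => [->|] /=; rewrite ?m0; lia.
  rewrite cardsU card_imset; last by move=> x y [].
  rewrite [X in (_ - X)%N](_ : _ = 0%N) ?subn0 //; apply/eqP; rewrite cards_eq0.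
  rewrite -subset0; apply/subsetP => -[x y]; rewrite !inE /= => /andP[/andP[_ h]].
  by case/imsetP => u _ [_ yv]; move: h; rewrite yv m0.
transitivity ((-1) ^+ #|inversions n m| *
   \sum_(v | v \notin supp n m) (-1) ^+ incidence_sign n (supp n m) v * c (v |: supp n m)).
  rewrite mulr_sumr; apply: eq_bigr => v vm; rewrite /alternant st // invE // suppE.
  by rewrite exprD mulrA.
by rewrite cyc mulr0.
Qed.

Lemma alternant_neq0 (K : fieldType) (n d : nat) (c : {set 'I_n} -> K) (t : {set 'I_n}) :
  #|t| = d.+1 -> c t != 0 -> exists m, alternant K n d c m != 0.
Proof.
move=> td ct; pose m := [multinom (if x \in t then (index x (enum t)).+1 else 0%N) | x < n].
have st : supp n m = t by apply/setP => x; rewrite inE mnmE; case: (x \in t).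
exists m; rewrite /alternant ifT ?st ?mulf_neq0 ?signr_eq0 //.
apply/staircaseP; split; rewrite ?st //.
  move=> x; rewrite mnmE; case: ifP => // xt.
  by rewrite -td cardE index_mem mem_enum.
move=> x y; rewrite !mnmE; case: ifP => // xt; case: ifP => // yt _ [].
by apply: (index_inj x); rewrite mem_enum.
Qed.

(** The family [z] defines a linear functional. The first hypothesis makes it vanish on the ideal
    and the last one on the multiples of [l], while it is nonzero on a monomial of degree i + 1;
    hence the cokernel is nonzero. *)
Lemma not_mul_surj (K : fieldType) (n i : nat) (G : {mpoly K[n]} -> Prop)
    (l : {mpoly K[n]}) (z : 'X_{1..n} -> K) (m0 : 'X_{1..n}) :
  (forall g m, in_ideal K n G g -> z m != 0 -> g@_m = 0) ->
  is_homog K n 1 l -> mdeg m0 = i.+1 -> z m0 != 0 ->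
  (forall m, \sum_v l@_U_(v) * z (m + U_(v))%MM = 0) -> ~ mul_surj K n G l i.
Proof.
move=> zG l1 dm0 zm0 zl surj.
(* Cutting off at degree i + 1 gives a finite sum and loses nothing for elements of degree i + 1. *)
pose L (g : {mpoly K[n]}) := \sum_(m : 'X_{1..n < i.+2}) g@_m * z m.
have LX m : (mdeg m < i.+2)%N -> L 'X_[m] = z m.
  move=> h; rewrite /L (bigD1 (BMultinom h)) //= mcoeffX eqxx mul1r big1 ?addr0 //.
  move=> b /negbTE bm; rewrite mcoeffX; case: (m =P b) => [mb|]; last by rewrite mul0r.
  by move: bm; rewrite -val_eqE /= mb eqxx.
have Lsum (I : eqType) (r : seq I) (a : I -> K) (E : I -> {mpoly K[n]}) :
    L (\sum_(j <- r) a j *: E j) = \sum_(j <- r) a j * L (E j).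
  rewrite /L (eq_bigr (fun m : 'X_{1..n < i.+2} => \sum_(j <- r) a j * ((E j)@_m * z m))).
    by rewrite exchange_big /=; apply: eq_bigr => j _; rewrite mulr_sumr.
  by move=> m _; rewrite raddf_sum /= mulr_suml; apply: eq_bigr => j _; rewrite mcoeffZ mulrA.
have LI g : in_ideal K n G g -> L g = 0.
  move=> gG; rewrite /L big1 // => m _; case: (eqVneq (z m) 0) => [->|zm].
    by rewrite mulr0.
  by rewrite (zG g) // mul0r.
have Xi : is_homog K n i.+1 'X_[m0].
  apply/is_homogP => m mi; rewrite mcoeffX.
  by case: (m0 =P m) mi => // <-; rewrite dm0 eqxx.
have [f [fi /LI Lf]] := surj _ Xi.
have lf0 : L (l * f) = 0.
  rewrite [f]mpolyE mulr_sumr.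
  under eq_bigr => m _ do rewrite -scalerAr.
  rewrite Lsum big_seq big1 // => m mf; rewrite linear_form_mulX // Lsum.
  rewrite (eq_bigr (fun v => l@_U_(v) * z (m + U_(v))%MM)) ?zl ?mulr0 // => v _.
  rewrite LX // mdegD mdeg1; move/allP/(_ _ mf)/eqP: fi => ->.
  by rewrite addn1.
case/eqP: zm0; rewrite -(LX m0) ?dm0 // -lf0; apply/eqP; rewrite -subr_eq0 -Lf.
by rewrite /L -sumrB; apply/eqP; apply: eq_bigr => m _; rewrite mcoeffB mulrBl.
Qed.

Lemma has_cycle_not_surj (K : fieldType) (n d : nat) (F : {set {set 'I_n}})
    (l : {mpoly K[n]}) : dfaces n d F -> has_cycle K n F -> is_homog K n 1 l ->
  ~ mul_surj K n (gens_AY K n d F) l (d * d.+3)./2.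
Proof.
move=> dF [c [[t ct] cF cyc]] l1; set z := alternant K n d c.
have td : #|t| = d.+1 by apply/eqP; apply: (forall_inP dF); apply: cF.
have zstd m : z m != 0 -> standard n d F m /\ mdeg m = (d * d.+3)./2.+1.
  rewrite /z /alternant; case: ifP => [sm|]; last by rewrite eqxx.
  rewrite mulf_eq0 signr_eq0 /= => cm; split; last exact: staircase_mdeg sm.
  case/staircaseP: sm => _ h _; apply/andP; split; first exact/forallP.
  by rewrite /face_of cF // orbT.
(* [dZ] is the degree in the variables that do not occur in [l]; [m1] maximizes it on the support of
   [z]. *)
pose dZ (m : 'X_{1..n}) := (\sum_(v | (l@_U_(v) == 0)%R) m v)%N.
have [m1 zm1 m1max] : exists2 m1, z m1 != 0 & forall m, z m != 0 -> (dZ m <= dZ m1)%N.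
  have [m zm] := alternant_neq0 K n d c t td ct.
  have monoE m' : z m' != 0 -> exists e, m' = mono_exp n d e.
    case/zstd => s1 /eqP s2; have /mono_expP[e _ ->] := introT andP (conj s1 s2).
    by exists e.
  have [e0 me0] := monoE m zm; rewrite -/z me0 in zm.
  case: (@arg_maxnP _ e0 (fun e => z (mono_exp n d e) != 0) (fun e => dZ (mono_exp n d e)) zm).
  move=> e ze emax; exists (mono_exp n d e) => // m' zm'.
  by have [e' e'E] := monoE m' zm'; rewrite e'E in zm' *; apply: emax.
(* Leading part of [z] for the degeneration sending the coefficients of [l] outside
   its support to 0, rescaled by the torus action on the remaining variables. *)
pose w (m : 'X_{1..n}) := \prod_(v | l@_U_(v) != 0) l@_U_(v) ^- m v.
pose z' (m : 'X_{1..n}) := if dZ m == dZ m1 then z m * w m else 0.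
have z'z m : z' m != 0 -> z m != 0.
  by rewrite /z'; case: ifP => _; rewrite ?eqxx // mulf_eq0 => /norP[].
apply: (not_mul_surj K n _ _ l z' m1) => //.
- move=> g m gI /z'z /zstd[sm _].
  by move/in_ideal_AYP: gI => /(_ dF); apply.
- by have [] := zstd _ zm1.
- rewrite /z' eqxx mulf_neq0 //; apply/prodf_neq0 => v v0.
  by rewrite invr_neq0 // expf_neq0.
move=> m; rewrite (bigID (fun v => l@_U_(v) == 0)) /= big1 ?add0r; last first.
  by move=> v /eqP ->; rewrite mul0r.
have dZE v : l@_U_(v) != 0 -> dZ (m + U_(v))%MM = dZ m.
  move=> v0; apply: eq_bigr => x /eqP x0; rewrite mnmDE mnm1E.
  by case: (v =P x) v0 => [->|]; rewrite ?x0 ?eqxx // addn0.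
have wE v : l@_U_(v) != 0 -> l@_U_(v) * w (m + U_(v))%MM = w m.
  move=> v0; rewrite /w (bigD1 v) //= [RHS](bigD1 v) //= mulrA; congr (_ * _).
    by rewrite mnmDE mnm1E eqxx addn1 exprS invfM mulrA divff ?mul1r.
  apply: eq_bigr => x /andP[_ xv]; rewrite mnmDE mnm1E eq_sym (negbTE xv).
  by rewrite addn0.
case: (dZ m =P dZ m1) => [e|ne]; last first.
  by rewrite big1 // => v v0; rewrite /z' dZE // (introF eqP ne) mulr0.
transitivity (w m * \sum_v z (m + U_(v))%MM); last first.
  by rewrite alternant_sum // mulr0.
rewrite mulr_sumr [RHS](bigID (fun v => l@_U_(v) == 0)) /= [X in _ = X + _]big1 ?add0r.
  apply: eq_bigr => v v0; rewrite /z' dZE // e eqxx -(wE v v0).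
  by rewrite mulrCA mulrC.
(* By maximality of [m1], raising a variable absent from [l] leaves the support of [z]; the sum over
   the variables of [l] is therefore the full sum of [alternant_sum]. *)
move=> v v0; case: (eqVneq (z (m + U_(v))%MM) 0) => [->|/m1max]; first by rewrite mulr0.
rewrite -e [X in (X <= _)%N](_ : _ = (dZ m).+1) ?ltnn // /dZ (bigD1 v) //=.
rewrite [X in _ = X.+1](bigD1 v) //= mnmDE mnm1E eqxx addn1 addSn; congr (_ + _).+1.
apply: eq_bigr => x /andP[_ xv].
by rewrite mnmDE mnm1E eq_sym (negbTE xv) addn0.
Qed.

(** The nonzero cycle provides a d-face, so the top degree is (d+1)^2, attained by the product of
    all x^(d+1) over the vertices of that face. The degree i = d(d+3)/2 lies below it. *)
Theorem has_cycle_not_WLP (K : fieldType) (n d : nat) (F : {set {set 'I_n}}) :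
  (0 < d)%N -> dfaces n d F -> (#|F| < 'C(n, d))%N -> has_cycle K n F ->
  ~ WLP K n (gens_AY K n d F).
Proof.
move=> d0 dF Fn cF [l [l1 /(_ (d.+1 * d.+1)%N)]]; set i := (d * d.+3)./2.
have i2 : (i.*2 = d * d.+3)%N by rewrite even_halfK // oddM /=; case: (odd d).
have top : top_degree K n (gens_AY K n d F) (d.+1 * d.+1).
  split.
    case: cF => c [[t ct] cF _]; have tF := cF t ct.
    have td : #|t| = d.+1 by apply/eqP; apply: (forall_inP dF).
    pose m := [multinom (if x \in t then d.+1 else 0%N) | x < n].
    move/(_ 'X_[m]); case.
      apply/is_homogP => m'; rewrite mcoeffX; case: (m =P m') => // <-.
      rewrite mdegE (eq_bigr (fun x => if x \in t then d.+1 else 0%N)); last first.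
        by move=> x _; rewrite mnmE.
      by rewrite -big_mkcond /= sum_nat_const td eqxx.
    move=> s [sG sE]; have : in_ideal K n (gens_AY K n d F) 'X_[m] by exists s.
    move/in_ideal_AYP => /(_ dF m); rewrite mcoeffX eqxx => h.
    apply/negP: (oner_neq0 K); rewrite negbK; apply/eqP/h; apply/andP; split.
      by apply/forallP => x; rewrite mnmE; case: ifP.
    have -> : supp n m = t by apply/setP => x; rewrite inE mnmE; case: ifP.
    by rewrite /face_of tF orbT.
  move=> j jD f /is_homogP fj; apply/in_ideal_AYP => // m /andP[/forallP m1 m2].
  apply: fj; apply: contraL jD => /eqP <-; rewrite -leqNgt mdegE.
  rewrite (bigID (mem (supp n m))) /= [X in (_ + X)%N]big1 ?addn0; last first.
    by move=> x; rewrite inE negbK => /eqP.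
  apply: leq_trans (leq_sum _ (fun x _ => m1 x)) _; rewrite sum_nat_const.
  rewrite leq_mul2r /=; case/orP: m2 => [|/(forall_inP dF) /eqP -> //].
  by move/leq_trans; apply.
move=> /(_ top i); case; first by nia.
  move/(mul_inj_card _ _ _ _ _ _ dF l1); apply/negP; rewrite -ltnNge.
  exact: card_monoset_gt.
exact: has_cycle_not_surj.
Qed.

(** * Random subsets *)

Section RandomSubset.
Variables (R : realFieldType) (T : finType) (pr : T -> R).
Hypothesis pr01 : forall t, 0 <= pr t <= 1.
Implicit Types (f g : {set T} -> R) (F : {set T}) (t : T).

(** The law of a random set containing each [t] independently with probability [pr t]. The
    probability depends on [t] so that sets of the wrong size can be given probability 0 later. *)
Definition weight (F : {set T}) : R := \prod_t (if t \in F then pr t else 1 - pr t).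

Definition expect (f : {set T} -> R) : R := \sum_(F : {set T}) weight F * f F.

(** The conditional expectation of [f] given all coordinates other than [t]. *)
Definition average (t : T) (f : {set T} -> R) (F : {set T}) : R :=
  pr t * f (t |: F) + (1 - pr t) * f (F :\ t).

Definition insensitive (t : T) (f : {set T} -> R) : Prop :=
  forall F, f (t |: F) = f (F :\ t).

Definition lipschitz (L : R) (f : {set T} -> R) : Prop :=
  forall t F, `|f (t |: F) - f (F :\ t)| <= L.

Lemma weight_ge0 F : 0 <= weight F.
Proof.
apply: prodr_ge0 => t _; have /andP[p0 p1] := pr01 t.
by case: ifP => _; rewrite ?subr_ge0.
Qed.

Lemma expect_const (a : R) : expect (fun=> a) = a.
Proof.
rewrite /expect -mulr_suml; suff -> : \sum_F weight F = 1 by rewrite mul1r.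
transitivity (\prod_(t : T) (pr t + (1 - pr t))); first by rewrite bigA_distr.
by rewrite big1 // => t _; rewrite subrKC.
Qed.

Lemma eq_expect f g : f =1 g -> expect f = expect g.
Proof. by move=> fg; apply: eq_bigr => F _; rewrite fg. Qed.

Lemma expectD f g : expect (fun F => f F + g F) = expect f + expect g.
Proof. by rewrite -big_split; apply: eq_bigr => F _; rewrite mulrDr. Qed.

Lemma expectZ a f : expect (fun F => a * f F) = a * expect f.
Proof. by rewrite mulr_sumr; apply: eq_bigr => F _; rewrite mulrCA. Qed.

Lemma expectB f g : expect (fun F => f F - g F) = expect f - expect g.
Proof.
rewrite -[X in _ = _ + X]mulN1r -expectZ -expectD.
by apply: eq_expect => F; rewrite mulN1r.
Qed.

Lemma expect_sum (I : Type) (r : seq I) (P : pred I) (f : I -> {set T} -> R) :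
  expect (fun F => \sum_(i <- r | P i) f i F) = \sum_(i <- r | P i) expect (f i).
Proof.
by rewrite exchange_big; apply: eq_bigr => F _; rewrite mulr_sumr.
Qed.

Lemma expect_le f g : (forall F, f F <= g F) -> expect f <= expect g.
Proof. by move=> fg; apply: ler_sum => F _; rewrite ler_wpM2l ?weight_ge0. Qed.

Lemma setD1_id t F : t \notin F -> F :\ t = F.
Proof.
move=> tF; apply/setP => x; rewrite !inE.
by case: eqP tF => // -> /negbTE ->.
Qed.

Lemma sum_set_split t (G : {set T} -> R) :
  \sum_F G F = \sum_(F : {set T} | t \notin F) (G (t |: F) + G F).
Proof.
rewrite (bigID (fun F : {set T} => t \in F)) big_split /=; congr (_ + _).
rewrite (reindex_onto (fun F : {set T} => t |: F) (fun F => F :\ t)) /=; last exact: setD1K.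
apply: eq_bigl => F; rewrite setU11 /=; have [tF|tF] := boolP (t \in F); last first.
  by rewrite setU1K ?eqxx.
by apply/eqP => e; move: tF; rewrite -e !inE eqxx.
Qed.

Lemma expect_average t f : expect (average t f) = expect f.
Proof.
rewrite /expect !(sum_set_split t); apply: eq_bigr => F tF.
rewrite /average setUA setUid setU1K // setD1_id //.
pose w0 := \prod_(s | s != t) (if s \in F then pr s else 1 - pr s).
have -> : weight F = (1 - pr t) * w0 by rewrite /weight (bigD1 t) //= (negbTE tF).
have -> : weight (t |: F) = pr t * w0.
  rewrite /weight (bigD1 t) //= setU11; congr (_ * _); apply: eq_bigr => s st.
  by rewrite !inE (negbTE st).
ring.
Qed.

Lemma setU1D1 t F : (t |: F) :\ t = F :\ t.
Proof. by apply/setP => x; rewrite !inE; case: eqP. Qed.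

Lemma setD1U1 t F : t |: (F :\ t) = t |: F.
Proof. by apply/setP => x; rewrite !inE; case: eqP. Qed.

Lemma setD1D1 t F : (F :\ t) :\ t = F :\ t.
Proof. by apply/setP => x; rewrite !inE; case: eqP. Qed.

Lemma setD1U1C s t F : s != t -> (s |: F) :\ t = s |: (F :\ t).
Proof.
move=> st; apply/setP => x; rewrite !inE; case: (eqVneq x s) => [->|] //=.
by rewrite st.
Qed.

Lemma average_insensitive t f : insensitive t (average t f).
Proof. by move=> F; rewrite /average setUA setUid setD1U1 setU1D1 setD1D1. Qed.

Lemma insensitive_average s t f : insensitive t f -> insensitive t (average s f).
Proof.
have [->|st] := eqVneq s t; first by move=> _; exact: average_insensitive.
have ts : t != s by rewrite eq_sym.
move=> tf F; rewrite /average setUCA -(setD1U1C s t) // (setD1U1C t s) // !tf.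
by have -> : F :\ t :\ s = F :\ s :\ t by rewrite setDDl setUC -setDDl.
Qed.

Lemma insensitive_const (f : {set T} -> R) :
  (forall t, insensitive t f) -> forall F, f F = f set0.
Proof.
move=> tf F; elim: {F}#|F| {-2}F (erefl #|F|) => [F /eqP|k IH F Fk].
  by rewrite cards_eq0 => /eqP ->.
have /card_gt0P[t tF] : (0 < #|F|)%N by rewrite Fk.
rewrite -[in LHS](setD1K tF) tf setD1D1; apply: IH.
by move: Fk; rewrite (cardsD1 t) tF => -[].
Qed.

Lemma lipschitz_average L s f : 0 <= L -> lipschitz L f -> lipschitz L (average s f).
Proof.
move=> L0 Lf t F; have [->|st] := eqVneq s t.
  by rewrite average_insensitive subrr normr0.
have ts : t != s by rewrite eq_sym.
rewrite /average setUCA -(setD1U1C s t) // (setD1U1C t s) //.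
have -> : F :\ t :\ s = F :\ s :\ t by rewrite setDDl setUC -setDDl.
rewrite opprD addrACA -!mulrBr.
have /andP[p0 p1] := pr01 s; apply: le_trans (ler_normD _ _) _.
rewrite !normrM ger0_norm // (ger0_norm (_ : 0 <= 1 - pr s)) ?subr_ge0 //.
have := Lf t (s |: F); have := Lf t (F :\ s).
set A := `|_|; set B := `|_| => hA hB.
have : pr s * B <= pr s * L by rewrite ler_wpM2l.
have : (1 - pr s) * A <= (1 - pr s) * L by rewrite ler_wpM2l ?subr_ge0.
lra.
Qed.

(** Given the other coordinates, [f] takes two values, and its conditional variance is pr(1 - pr)
    times the square of their difference. *)
Lemma variance_average L t f : lipschitz L f ->
  expect (fun F => f F ^+ 2) - expect (fun F => average t f F ^+ 2) <=
  pr t * (1 - pr t) * L ^+ 2.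
Proof.
move=> Lf; rewrite -(expect_average t) -expectB -[leRHS]expect_const.
apply: expect_le => F; rewrite /average.
have /andP[p0 p1] := pr01 t.
have : (f (t |: F) - f (F :\ t)) ^+ 2 <= L ^+ 2.
  by rewrite -real_normK ?num_real // lerXn2r ?nnegrE // (le_trans _ (Lf t F)).
move=> h; have q0 : 0 <= pr t * (1 - pr t) by rewrite mulr_ge0 ?subr_ge0.
have := ler_wpM2l q0 h; apply: le_trans; rewrite le_eqVlt; apply/orP; left; apply/eqP.
ring.
Qed.

(* Average out the coordinates one at a time: each costs at most [pr (1 - pr) L^2]
   of the second moment, and the final function is constant. *)
Lemma efron_stein L f : 0 <= L -> lipschitz L f ->
  expect (fun F => f F ^+ 2) - expect f ^+ 2 <= \sum_t pr t * (1 - pr t) * L ^+ 2.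
Proof.
move=> L0 Lf.
have main (r : seq T) : exists g : {set T} -> R,
    [/\ lipschitz L g, expect g = expect f, forall t, t \in r -> insensitive t g &
     expect (fun F => f F ^+ 2) - expect (fun F => g F ^+ 2) <=
     \sum_(t <- r) pr t * (1 - pr t) * L ^+ 2].
  elim: r => [|t r [g [Lg Eg ig Vg]]].
    by exists f; split; rewrite ?big_nil ?subrr.
  exists (average t g); split; first exact: lipschitz_average.
  - by rewrite expect_average.
  - move=> s; rewrite inE => /orP[/eqP ->|/ig]; first exact: average_insensitive.
    exact: insensitive_average.
  - by rewrite big_cons; have := variance_average _ t g Lg; move: Vg; lra.
have [g [_ Eg ig Vg]] := main (index_enum T).
have gc := insensitive_const g (fun t => ig t (mem_index_enum t)).
move: Vg; rewrite -Eg (eq_expect _ _ gc).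
by rewrite (eq_expect (fun F => g F ^+ 2) (fun=> g set0 ^+ 2)) ?expect_const // => F; rewrite gc.
Qed.

(** Markov's inequality for the squared deviation, with the variance bounded by [efron_stein] and
    each factor 1 - pr bounded by 1. *)
Lemma chebyshev L a f (A : pred {set T}) : 0 <= L -> 0 < a -> lipschitz L f ->
  (forall F, A F -> a <= `|f F - expect f|) ->
  expect (fun F => (A F)%:R) <= (\sum_t pr t) * (L / a) ^+ 2.
Proof.
move=> L0 a0 Lf Af; set e := expect f.
have a2 : 0 < a ^+ 2 by rewrite exprn_gt0.
have h1 : expect (fun F => (A F)%:R) * a ^+ 2 <= expect (fun F => (f F - e) ^+ 2).
  rewrite mulrC -expectZ; apply: expect_le => F; case: (boolP (A F)) => [/Af aF|_].
    rewrite mulr1 -[leRHS]real_normK ?num_real // lerXn2r ?nnegrE ?normr_ge0 //.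
    exact: ltW.
  by rewrite mulr0 sqr_ge0.
have h2 : expect (fun F => (f F - e) ^+ 2) = expect (fun F => f F ^+ 2) - e ^+ 2.
  rewrite (eq_expect _ (fun F => f F ^+ 2 + ((- e *+ 2) * f F + e ^+ 2))).
    by rewrite expectD expectD expectZ expect_const -/e; ring.
  by move=> F; ring.
have h3 : \sum_t pr t * (1 - pr t) * L ^+ 2 <= (\sum_t pr t) * L ^+ 2.
  rewrite mulr_suml; apply: ler_sum => t _; have /andP[p0 p1] := pr01 t.
  by rewrite ler_wpM2r ?sqr_ge0 // ler_piMr // lerBlDr lerDl.
rewrite expr_div_n mulrA ler_pdivlMr //; apply: le_trans h1 _.
by rewrite h2; apply: le_trans h3; apply: efron_stein.
Qed.

Lemma insensitiveM t f g : insensitive t f -> insensitive t g ->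
  insensitive t (fun F => f F * g F).
Proof. by move=> tf tg F; rewrite tf tg. Qed.

Lemma insensitive_prod (I : eqType) (r : seq I) t (f : I -> {set T} -> R) :
  (forall i, i \in r -> insensitive t (f i)) ->
  insensitive t (fun F => \prod_(i <- r) f i F).
Proof. by move=> h F; apply: eq_big_seq => i /h ->. Qed.

Lemma insensitive_mem s t (b : bool -> R) :
  s != t -> insensitive t (fun F => b (s \in F)).
Proof. by move=> st F; rewrite !inE st (negbTE st). Qed.

Lemma expect_mem t f : insensitive t f ->
  expect (fun F => f F * (t \in F)%:R) = pr t * expect f.
Proof.
move=> tf; rewrite -(expect_average t) -(expect_average t f) -expectZ.
apply: eq_expect => F; rewrite /average tf !inE eqxx /=; ring.
Qed.

Lemma expect_notin t f : insensitive t f ->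
  expect (fun F => f F * (t \notin F)%:R) = (1 - pr t) * expect f.
Proof.
move=> tf; rewrite -(expect_average t) -(expect_average t f) -expectZ.
apply: eq_expect => F; rewrite /average tf !inE eqxx /=; ring.
Qed.

Lemma expect_avoid (r : seq T) f : uniq r ->
  (forall t, t \in r -> insensitive t f) ->
  expect (fun F => f F * \prod_(t <- r) (t \notin F)%:R) =
  (\prod_(t <- r) (1 - pr t)) * expect f.
Proof.
elim: r => [|t r IH] /=.
  move=> _ _; rewrite big_nil mul1r.
  by apply: eq_expect => F; rewrite big_nil mulr1.
move=> /andP[tr ur] ins; rewrite big_cons -mulrA -IH //; last first.
  by move=> s sr; apply: ins; rewrite inE sr orbT.
rewrite -expect_notin.
  by apply: eq_expect => F; rewrite big_cons mulrCA mulrC.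
apply: insensitiveM; first by apply: ins; rewrite inE eqxx.
apply: insensitive_prod => s sr; apply: (insensitive_mem s t (fun b => (~~ b)%:R)).
by apply: contraNneq tr => <-.
Qed.

Lemma expect_contain (r : seq T) : uniq r ->
  expect (fun F => \prod_(t <- r) (t \in F)%:R) = \prod_(t <- r) pr t.
Proof.
elim: r => [|t r IH] /=.
  move=> _; rewrite big_nil -[RHS]expect_const.
  by apply: eq_expect => F; rewrite big_nil.
move=> /andP[tr ur]; rewrite big_cons -IH // -expect_mem.
  by apply: eq_expect => F; rewrite big_cons mulrC.
apply: insensitive_prod => s sr; apply: (insensitive_mem s t (fun b => b%:R)).
by apply: contraNneq tr => <-.
Qed.

End RandomSubset.

(** * Nullity of the boundary map *)

Section RowRank.
Variables (K : fieldType) (T : finType) (B : T -> T -> K).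

(** Rows and columns use the same index type, so that boundary maps of all dimensions sit in one
    square array and only the set of rows [A] has to be chosen. *)
Definition rows_of (A : {set T}) : 'M[K]_(#|A|, #|T|) :=
  \matrix_(k, j) B (enum_val k) (enum_val j).

Definition rank_of (A : {set T}) : nat := \rank (rows_of A).

Lemma row_rows_of_sub (A : {set T}) t : t \in A ->
  (\row_(j < #|T|) B t (enum_val j) <= rows_of A)%MS.
Proof.
move=> tA; have -> : \row_(j < #|T|) B t (enum_val j) = row (enum_rank_in tA t) (rows_of A).
  by apply/rowP => j; rewrite !mxE enum_rankK_in.
exact: row_sub.
Qed.

Lemma row_rows_of (A : {set T}) (k : 'I_#|A|) :
  row k (rows_of A) = \row_(j < #|T|) B (enum_val k) (enum_val j).
Proof. by apply/rowP => j; rewrite !mxE. Qed.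

Lemma rank_of_sub (A A' : {set T}) : A \subset A' -> (rank_of A <= rank_of A')%N.
Proof.
move=> /subsetP AA'; apply/mxrankS/row_subP => k; rewrite row_rows_of.
by apply: row_rows_of_sub; apply: AA'; apply: enum_valP.
Qed.

Lemma rank_of_diff (A A' : {set T}) : (rank_of A' <= rank_of A + #|A' :\: A|)%N.
Proof.
apply: leq_trans (_ : \rank (rows_of A + rows_of (A' :\: A))%MS <= _)%N.
  apply/mxrankS/row_subP => k; rewrite row_rows_of.
  have [kA|kA] := boolP (enum_val k \in A).
    exact: submx_trans (row_rows_of_sub _ _ kA) (addsmxSl _ _).
  apply: submx_trans (addsmxSr _ _); apply: row_rows_of_sub.
  by rewrite inE kA enum_valP.
apply: leq_trans (mxrank_adds_leqif _ _) _.
by rewrite leq_add2l rank_leq_row.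
Qed.

Lemma rank_of_le_col (A C : {set T}) :
  (forall t s, t \in A -> B t s != 0 -> s \in C) -> (rank_of A <= #|C|)%N.
Proof.
move=> AC; rewrite /rank_of -mxrank_tr.
pose N := \matrix_(k < #|C|, j < #|A|) B (enum_val j) (enum_val k).
apply: leq_trans (rank_leq_row N); apply/mxrankS/row_subP => s.
have [sC|sC] := boolP (enum_val s \in C).
  have -> : row s (rows_of A)^T = row (enum_rank_in sC (enum_val s)) N.
    by apply/rowP => j; rewrite !mxE enum_rankK_in.
  exact: row_sub.
suff -> : row s (rows_of A)^T = 0 by exact: sub0mx.
apply/rowP => j; rewrite !mxE; apply: contraNeq sC; apply: AC; exact: enum_valP.
Qed.

Lemma rank_lt_dependency (A : {set T}) : (rank_of A < #|A|)%N ->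
  exists c : T -> K, [/\ exists t, c t != 0, forall t, c t != 0 -> t \in A &
    forall s, \sum_t c t * B t s = 0].
Proof.
move=> rA; have : kermx (rows_of A) != 0.
  by rewrite kermx_eq0 /row_free neq_ltn rA.
case/rowV0Pn => w; rewrite sub_kermx => /eqP wA w0.
pose c t := \sum_k (enum_val k == t)%:R * w 0 k; exists c; split.
- apply/existsP; apply: contraNT w0; rewrite negb_exists => /forallP c0.
  apply/eqP/rowP => k; rewrite mxE; apply/eqP; move: (c0 (enum_val k)); rewrite negbK /c.
  rewrite (bigD1 k) //= eqxx mul1r big1 ?addr0 // => j /negbTE jk.
  by rewrite (inj_eq enum_val_inj) jk mul0r.
- move=> t; apply: contraNT => tA; rewrite /c big1 // => k _.
  by case: eqP tA => [<-|]; rewrite ?enum_valP ?mul0r.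
move=> s; have := congr1 (fun M : 'rV_ _ => M 0 (enum_rank s)) wA.
rewrite !mxE => {2}<-; rewrite /c.
under eq_bigr => t _ do rewrite mulr_suml.
rewrite exchange_big /=; apply: eq_bigr => k _.
rewrite (bigD1 (enum_val k)) //= eqxx mul1r big1 ?addr0; last first.
  by move=> t /negbTE tk; rewrite eq_sym tk !mul0r.
by rewrite mxE enum_rankK.
Qed.

End RowRank.

(** * The boundary matrix and a lower bound for its nullity *)

Definition star (n : nat) (s : {set 'I_n}) : {set {set 'I_n}} :=
  [set v |: s | v in ~: s].

(** At most one term is nonzero, the one with [v |: s] equal to [t]; the sum avoids selecting that
    vertex. *)
Definition boundary_coef (K : fieldType) (n : nat) (t s : {set 'I_n}) : K :=
  \sum_(v | v \notin s) (v |: s == t)%:R * (-1) ^+ incidence_sign n s v.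

(** The faces of [F] without a free facet, that is, those left by one round of collapses. *)
Definition good_faces (n : nat) (F : {set {set 'I_n}}) : {set {set 'I_n}} :=
  [set t in F | [forall v in t, 1 < #|star n (t :\ v) :&: F|]]%N.

Definition heavy_faces (n d : nat) (F : {set {set 'I_n}}) : {set {set 'I_n}} :=
  [set s : {set 'I_n} | (#|s| == d) && (1 < #|star n s :&: F|)]%N.

Lemma boundary_coef_neq0 (K : fieldType) (n : nat) (t s : {set 'I_n}) :
  boundary_coef K n t s != 0 -> exists v, v \in t /\ s = t :\ v.
Proof.
move=> h; suff /existsP[v /andP[vs /eqP <-]] : [exists v, (v \notin s) && (v |: s == t)].
  by exists v; rewrite setU11 setU1K.
apply: contraNT h; rewrite negb_exists => /forallP h; rewrite /boundary_coef big1 //.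
by move=> v vs; have := h v; rewrite vs /= => /negbTE ->; rewrite mul0r.
Qed.

Lemma rank_lt_has_cycle (K : fieldType) (n : nat) (F : {set {set 'I_n}}) :
  (rank_of K _ (boundary_coef K n) F < #|F|)%N -> has_cycle K n F.
Proof.
case/rank_lt_dependency => c [c0 cF cB]; exists c; split=> // s.
rewrite -[RHS](cB s) /boundary_coef.
under [RHS]eq_bigr => t _ do rewrite mulr_sumr.
rewrite exchange_big /=; apply: eq_bigr => v _.
rewrite (bigD1 (v |: s)) //= eqxx mul1r mulrC big1 ?addr0 // => t /negbTE tv.
by rewrite eq_sym tv mul0r mulr0.
Qed.

(** The rows of the good faces vanish outside the columns of the heavy (d-1)-faces, so their rank is
    at most the number of these; each other face adds at most 1 to the rank. *)
Lemma nullity_ge (K : fieldType) (n d : nat) (F : {set {set 'I_n}}) : dfaces n d F ->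
  (rank_of K _ (boundary_coef K n) F + #|good_faces n F| <=
   #|F| + #|heavy_faces n d F|)%N.
Proof.
move=> dF; have gF : good_faces n F \subset F by apply/subsetP => t; rewrite inE => /andP[].
have h1 := rank_of_diff K _ (boundary_coef K n) (good_faces n F) F.
have h2 : (rank_of K _ (boundary_coef K n) (good_faces n F) <= #|heavy_faces n d F|)%N.
  apply: rank_of_le_col => t s; rewrite inE => /andP[tF /forall_inP tg].
  case/boundary_coef_neq0 => v [vt ->]; rewrite inE tg // andbT.
  by have := forall_inP dF _ tF; rewrite (cardsD1 v) vt.
rewrite -(cardsID (good_faces n F) F) (setIidPr gF) addnC -addnA leq_add2l.
by apply: leq_trans h1 _; rewrite addnC leq_add2l.
Qed.

(** * Expected face counts and concentration for the random complex *)

Section Expectations.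
Variables (R : realFieldType) (n d : nat) (p : R).
Hypothesis p01 : 0 <= p <= 1.

(** Sets of the wrong size have probability 0, so the product law on all families of vertex sets is
    concentrated on families of d-faces. *)
Definition face_prob (t : {set 'I_n}) : R := if #|t| == d.+1 then p else 0.

Lemma face_prob01 t : 0 <= face_prob t <= 1.
Proof. by rewrite /face_prob; case: ifP; rewrite ?lexx ?ler01. Qed.

Local Notation E := (expect R _ face_prob).

Lemma star_card (s : {set 'I_n}) : #|star n s| = (n - #|s|)%N.
Proof.
rewrite card_in_imset; first by rewrite cardsCs setCK card_ord.
move=> v w; rewrite !inE => vs ws vw; have : v \in w |: s by rewrite -vw setU11.
by rewrite !inE (negbTE vs) orbF => /eqP.
Qed.

Lemma star_mem_card (s t : {set 'I_n}) : t \in star n s -> #|t| = #|s|.+1.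
Proof. by case/imsetP => v; rewrite inE => vs ->; rewrite cardsU1 vs. Qed.

Lemma prod_mem_eq (A F : {set {set 'I_n}}) :
  (\prod_(t <- enum A) (t \notin F)%:R : R) = (A :&: F == set0)%:R.
Proof.
have [/eqP AF|AF] := boolP (_ == _).
  rewrite big_seq big1 // => t; rewrite mem_enum => tA.
  have : t \notin A :&: F by rewrite AF inE.
  by rewrite inE tA /= => ->.
case/set0Pn: AF => t; rewrite inE => /andP[tA tF].
by rewrite (big_rem t) /= ?mem_enum // tF mul0r.
Qed.

Lemma expect_avoid_set (A : {set {set 'I_n}}) (f : {set {set 'I_n}} -> R) :
  (forall t, t \in A -> #|t| = d.+1) ->
  (forall t, t \in A -> insensitive R _ t f) ->
  E (fun F => f F * (A :&: F == set0)%:R) = (1 - p) ^+ #|A| * E f.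
Proof.
move=> Ad Af.
rewrite (eq_expect _ _ _ _ (fun F => f F * \prod_(t <- enum A) (t \notin F)%:R)); last first.
  by move=> F; rewrite prod_mem_eq.
rewrite expect_avoid ?enum_uniq //; last by move=> t; rewrite mem_enum; apply: Af.
congr (_ * _); rewrite big_enum /= -prodr_const; apply: eq_bigr => t tA.
by rewrite /face_prob Ad ?eqxx.
Qed.

Lemma insensitive_avoid (A : {set {set 'I_n}}) t : t \notin A ->
  insensitive R _ t (fun F => (A :&: F == set0)%:R).
Proof.
move=> tA F; congr ((_ == set0)%:R); apply/setP => x; rewrite !inE.
by case: (x =P t) => [->|] //=; rewrite (negbTE tA).
Qed.

Definition other_cofaces (t : {set 'I_n}) (v : 'I_n) : {set {set 'I_n}} :=
  star n (t :\ v) :\ t.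

Lemma mem_star_D1 (t : {set 'I_n}) v : v \in t -> t \in star n (t :\ v).
Proof. by move=> vt; apply/imsetP; exists v; rewrite ?inE ?eqxx ?setD1K. Qed.

Lemma cardsD1_face (t : {set 'I_n}) v : #|t| = d.+1 -> v \in t -> #|t :\ v| = d.
Proof. by rewrite (cardsD1 v) => + vt; rewrite vt => -[]. Qed.

Lemma card_other_cofaces (t : {set 'I_n}) v : #|t| = d.+1 -> v \in t ->
  #|other_cofaces t v| = (n - d.+1)%N.
Proof.
move=> td vt; have := star_card (t :\ v); rewrite (cardsD1_face _ _ td vt).
by rewrite (cardsD1 t) mem_star_D1 // /other_cofaces subnS => <-.
Qed.

(** Two distinct facets of [t] have union [t], so a set of the same size containing both is [t].
    This disjointness makes the degrees of the facets of [t] independent once [t] is present. *)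
Lemma other_cofaces_disjoint (t s : {set 'I_n}) v w : s \in other_cofaces t v ->
  s \in other_cofaces t w -> v \in t -> w \in t -> v = w.
Proof.
rewrite !in_setD1 => /andP[st sv] /andP[_ sw] vt wt.
have sub x : s \in star n (t :\ x) -> t :\ x \subset s.
  by case/imsetP => y _ ->; apply: subsetUr.
apply/eqP; apply: contraNT st => vw; rewrite eq_sym eqEcard; apply/andP; split.
  apply/subsetP => x xt; have [->|xv] := eqVneq x v.
    by apply: (subsetP (sub w sw)); rewrite in_setD1 vw.
  by apply: (subsetP (sub v sv)); rewrite in_setD1 xv.
by rewrite (star_mem_card _ _ sv) [leqRHS](cardsD1 v) vt.
Qed.

(** When [t] is present, a facet has degree at least 2 exactly if one of its n - d - 1 other cofaces
    is present. These d + 1 events depend on disjoint sets of coordinates, none of which contains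
    [t]. *)
Lemma expect_good_face (t : {set 'I_n}) : #|t| = d.+1 ->
  E (fun F => (t \in good_faces n F)%:R) = p * (1 - (1 - p) ^+ (n - d.+1)) ^+ d.+1.
Proof.
move=> td; set q := 1 - _.
pose g r F : R := \prod_(v <- r) (1 - (other_cofaces t v :&: F == set0)%:R).
have gins r s : (forall v, v \in r -> s \notin other_cofaces t v) ->
    insensitive R _ s (g r).
  move=> h; apply: insensitive_prod => v /h sv F.
  by rewrite (insensitive_avoid _ _ sv).
have Eg r : uniq r -> {subset r <= t} -> E (g r) = q ^+ size r.
  elim: r => [|v r IH] /=.
    move=> _ _; rewrite expr0 -[RHS](expect_const R _ face_prob).
    by apply: eq_expect => F; rewrite /g big_nil.
  move=> /andP[vr ur] rt; have vt : v \in t by apply: rt; rewrite inE eqxx.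
  have rt' : {subset r <= t} by move=> w wr; apply: rt; rewrite inE wr orbT.
  rewrite exprS -IH //.
  rewrite (eq_expect _ _ _ _ (fun F => g r F - g r F * (other_cofaces t v :&: F == set0)%:R)).
    rewrite expectB expect_avoid_set ?card_other_cofaces //; first by rewrite /q; ring.
      move=> s; rewrite in_setD1 => /andP[_ /star_mem_card ->].
      by rewrite (cardsD1_face _ _ td vt).
    move=> s sv; apply: gins => w wr; apply: contra vr => sw.
    by rewrite (other_cofaces_disjoint _ _ _ _ sv sw vt (rt' _ wr)).
  by move=> F; rewrite /g big_cons; ring.
rewrite -[d.+1 in RHS]td cardE -Eg ?enum_uniq //; last by move=> v; rewrite mem_enum.
have <- : face_prob t = p by rewrite /face_prob td eqxx.
rewrite -expect_mem; last by apply: gins => v; rewrite mem_enum => vt; rewrite !inE eqxx.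
apply: eq_expect => F; rewrite inE andbC; case: (boolP (t \in F)) => tF; last first.
  by rewrite andbF mulr0.
rewrite andbT mulr1 /g.
have goodE v : v \in t -> (1 < #|star n (t :\ v) :&: F|)%N =
    (other_cofaces t v :&: F != set0).
  move=> vt; rewrite (cardsD1 t) inE tF mem_star_D1 // ltnS card_gt0.
  by congr (_ != _); apply/setP => x; rewrite !inE; case: eqP.
have [/forall_inP h|] := boolP [forall v in t, (1 < #|star n (t :\ v) :&: F|)%N].
  rewrite big_seq big1 // => v; rewrite mem_enum => vt.
  by move: (h v vt); rewrite goodE // => /negbTE ->; rewrite subr0.
case/forall_inPn => v vt; rewrite goodE // negbK => /eqP h.
by rewrite (big_rem v) ?mem_enum //= h eqxx subrr mul0r.
Qed.

Lemma expect_heavy_face (s : {set 'I_n}) : #|s| = d ->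
  E (fun F => (1 < #|star n s :&: F|)%N%:R) =
  1 - (1 - p) ^+ (n - d) - (n - d)%:R * (p * (1 - p) ^+ (n - d).-1).
Proof.
move=> sd; have cS := star_card s; rewrite sd in cS.
have fS t : t \in star n s -> #|t| = d.+1 by move=> /star_mem_card ->; rewrite sd.
pose Z (A F : {set {set 'I_n}}) : R := (A :&: F == set0)%:R.
have EZ (A : {set {set 'I_n}}) : A \subset star n s -> E (Z A) = (1 - p) ^+ #|A|.
  move=> /subsetP AS; rewrite -[RHS]mulr1 -[X in _ = _ * X](expect_const R _ face_prob 1).
  rewrite -expect_avoid_set //; last by move=> t /AS/fS.
  by apply: eq_expect => F; rewrite mul1r.
(* Subtract from 1 the events that no coface of [s] is present and that exactly one coface [t]
   is. *)
rewrite (eq_expect _ _ _ _ (fun F => 1 - Z (star n s) F -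
   \sum_(t in star n s) Z (star n s :\ t) F * (t \in F)%:R)).
  rewrite expectB expectB expect_const EZ // cS; congr (_ - _).
  rewrite expect_sum (eq_bigr (fun=> p * (1 - p) ^+ (n - d).-1)).
    by rewrite sumr_const cS mulr_natl.
  move=> t tS; rewrite expect_mem; last by apply: insensitive_avoid; rewrite !inE eqxx.
  rewrite EZ ?subsetDl // /face_prob fS // eqxx.
  by rewrite -cS (cardsD1 t (star n s)) tS.
move=> F; have ZE t : t \in star n s ->
    Z (star n s :\ t) F * (t \in F)%:R = (star n s :&: F == [set t])%:R.
  move=> tS; rewrite /Z; have [tF|tF] := boolP (t \in F); last first.
    rewrite mulr0; case: eqP => // /setP /(_ t).
    by rewrite !inE (negbTE tF) andbF eqxx.
  rewrite mulr1; congr (_%:R); congr nat_of_bool.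
  have -> : (star n s :\ t) :&: F = (star n s :&: F) :\ t.
    by apply/setP => x; rewrite !inE andbA.
  apply/eqP/eqP => [h|->]; last by rewrite setDv.
  by rewrite -(setD1K (_ : t \in (star n s :&: F))) ?h ?setU0 // inE tS.
rewrite (eq_bigr _ ZE) /Z -cards_eq0.
case E1 : #|star n s :&: F| => [|[|k]] /=.
- rewrite big1 ?subrr ?subr0 // => t _; case: eqP => // h.
  by move: E1; rewrite h cards1.
- have /eqP/cards1P[t h] := E1.
  have tS : t \in star n s.
    by have : t \in star n s :&: F; [rewrite h inE | rewrite inE => /andP[]].
  rewrite (bigD1 t) //= h eqxx big1 ?addr0 ?subr0 ?subrr // => x /andP[_ xt].
  by rewrite (inj_eq set1_inj) eq_sym (negbTE xt).
- rewrite big1 ?subr0 // => t _; case: eqP => // h.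
  by move: E1; rewrite h cards1.
Qed.

Lemma weight_dfaces (F : {set {set 'I_n}}) : ~~ dfaces n d F -> weight R _ face_prob F = 0.
Proof.
case/forall_inPn => t tF td; rewrite /weight (bigD1 t) //= tF /face_prob (negbTE td).
by rewrite mul0r.
Qed.

Lemma expect_le_dfaces (f g : {set {set 'I_n}} -> R) :
  (forall F, dfaces n d F -> f F <= g F) -> E f <= E g.
Proof.
move=> fg; apply: ler_sum => F _; have [dF|dF] := boolP (dfaces n d F).
  by rewrite ler_wpM2l ?fg ?weight_ge0 //; apply: face_prob01.
by rewrite weight_dfaces // !mul0r.
Qed.

Lemma card_sets (k : nat) : #|[pred t : {set 'I_n} | #|t| == k]| = 'C(n, k).
Proof.
rewrite -[in RHS](card_ord n) -card_draws.
by apply: eq_card => t; rewrite !inE.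
Qed.

Lemma sum_face_prob : \sum_t face_prob t = 'C(n, d.+1)%:R * p.
Proof.
rewrite /face_prob -big_mkcond /= (eq_bigl [pred t : {set 'I_n} | #|t| == d.+1]) //.
by rewrite sumr_const card_sets mulr_natl.
Qed.

Lemma card_sum (A : {set {set 'I_n}}) : #|A|%:R = \sum_t (t \in A)%:R :> R.
Proof. by rewrite -sum1_card natr_sum big_mkcond; apply: eq_bigr => t _; case: (_ \in _). Qed.

Lemma expect_card : E (fun F => #|F|%:R) = 'C(n, d.+1)%:R * p.
Proof.
rewrite -sum_face_prob (eq_expect _ _ _ _ _ card_sum) expect_sum.
apply: eq_bigr => t _; rewrite -[RHS]mulr1 -[X in _ = _ * X](expect_const R _ face_prob 1) -expect_mem //.
by apply: eq_expect => F; rewrite mul1r.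
Qed.

Lemma cardsU1D1 (T : finType) (t : T) (F : {set T}) : #|t |: F| = #|F :\ t|.+1.
Proof. by rewrite -setD1U1 cardsU1 !inE eqxx. Qed.

Lemma card_lipschitz : lipschitz R _ 1 (fun F : {set {set 'I_n}} => #|F|%:R).
Proof. by move=> t F; rewrite cardsU1D1 mulrS addrK normr1. Qed.

Lemma many_faces_prob : 'C(n, d.+1)%:R * p < 'C(n, d)%:R ->
  E (fun F => ('C(n, d) <= #|F|)%N%:R) <=
  'C(n, d.+1)%:R * p * (1 / ('C(n, d)%:R - 'C(n, d.+1)%:R * p)) ^+ 2.
Proof.
move=> lt; rewrite -[X in X * _]sum_face_prob.
apply: (chebyshev _ _ _ face_prob01 _ _ _ _ ler01 _ card_lipschitz); first by rewrite subr_gt0.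
move=> F; rewrite -(ler_nat R) expect_card => h.
by apply: le_trans (ler_norm _); rewrite lerB.
Qed.

Variable K : fieldType.

Definition nullity (F : {set {set 'I_n}}) : R :=
  #|F|%:R - (rank_of K _ (boundary_coef K n) F)%:R.

(** A new face adds one row, and the rank then grows by 0 or 1. *)
Lemma nullity_lipschitz : lipschitz R _ 1 nullity.
Proof.
move=> t F; rewrite /nullity cardsU1D1.
set B := boundary_coef K n.
have h1 : (rank_of K _ B (F :\ t) <= rank_of K _ B (t |: F))%N.
  by apply: rank_of_sub; rewrite -setD1U1 subsetUr.
have h2 : (rank_of K _ B (t |: F) <= rank_of K _ B (F :\ t) + 1)%N.
  apply: leq_trans (rank_of_diff _ _ _ (F :\ t) _) _; rewrite leq_add2l.
  rewrite -(cards1 t); apply: subset_leq_card; apply/subsetP => x; rewrite !inE.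
  by case: eqP => //= _ /andP[/negbTE ->].
move: h1 h2; rewrite -!(ler_nat R) natrD mulrS => h1 h2.
by rewrite ler_norml; apply/andP; split; lra.
Qed.

(** The expected number of good d-faces minus the expected number of heavy (d-1)-faces. *)
Definition nullity_bound : R :=
  'C(n, d.+1)%:R * (p * (1 - (1 - p) ^+ (n - d.+1)) ^+ d.+1) -
  'C(n, d)%:R * (1 - (1 - p) ^+ (n - d) - (n - d)%:R * (p * (1 - p) ^+ (n - d).-1)).

Lemma expect_nullity : nullity_bound <= E nullity.
Proof.
apply: le_trans (_ : E (fun F => #|good_faces n F|%:R - #|heavy_faces n d F|%:R) <= _).
  rewrite expectB; apply: lerB.
    rewrite (eq_expect _ _ _ _ (fun F => \sum_t (t \in good_faces n F)%:R)); last first.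
      by move=> F; rewrite card_sum.
    rewrite expect_sum (bigID [pred t : {set 'I_n} | #|t| == d.+1]) /=.
    rewrite (eq_bigr _ (fun t td => expect_good_face t (eqP td))) sumr_const card_sets.
    rewrite mulr_natl lerDl; apply: sumr_ge0 => t _.
    rewrite -(expect_const R _ face_prob 0); apply: expect_le => //.
    exact: face_prob01.
  rewrite (eq_expect _ _ _ _ (fun F =>
    \sum_(s : {set 'I_n} | #|s| == d) (1 < #|star n s :&: F|)%N%:R)).
    rewrite expect_sum (eq_bigr _ (fun t td => expect_heavy_face t (eqP td))).
    by rewrite sumr_const card_sets [leRHS]mulr_natl.
  move=> F; rewrite card_sum [RHS]big_mkcond; apply: eq_bigr => s _; rewrite inE.
  by case: (_ == d).
apply: expect_le_dfaces => F dF; have := nullity_ge K n d F dF.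
rewrite -(ler_nat R) !natrD /nullity; lra.
Qed.

Lemma no_cycle_prob : 0 < nullity_bound ->
  E (fun F => (nullity F <= 0)%R%:R) <= 'C(n, d.+1)%:R * p * (1 / nullity_bound) ^+ 2.
Proof.
move=> b0; rewrite -sum_face_prob.
apply: (chebyshev _ _ _ face_prob01 _ _ _ (fun F => nullity F <= 0) ler01 b0 nullity_lipschitz).
move=> F h; rewrite -normrN; apply: le_trans (ler_norm _).
have := expect_nullity; lra.
Qed.

Lemma nullity_gt0_has_cycle F : 0 < nullity F -> has_cycle K n F.
Proof. by rewrite subr_gt0 ltr_nat; apply: rank_lt_has_cycle. Qed.

End Expectations.

(** * Cycles in random graphs *)

Section CyclicSuccessor.
Variable k : nat.
Implicit Types i j : 'I_k.+3.

Lemma ordS_neq i : ordS i != i.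
Proof.
rewrite -val_eqE /=; have := ltn_ord i; case: (ltnP i.+1 k.+3) => h1 h2.
  by rewrite modn_small // neq_ltn ltnSn orbT.
by have -> : i.+1 = k.+3 by [lia]; rewrite modnn; lia.
Qed.

Lemma ordSS_neq i : ordS (ordS i) != i.
Proof.
rewrite -val_eqE /= -addn1 modnDml addn1; have := ltn_ord i.
case: (ltnP i.+2 k.+3) => h1 h2.
  by rewrite modn_small //; lia.
have -> : i.+2 = (i.+2 - k.+3 + k.+3)%N by lia.
by rewrite modnDr modn_small; lia.
Qed.

Lemma ordS_closed (S : {set 'I_k.+3}) i : i \in S ->
  (forall j, j \in S -> ordS j \in S) -> S = setT.
Proof.
move=> iS cl; apply/setP => j; rewrite inE.
have it m : iter m (@ordS k.+3) i \in S by elim: m => //= m; apply: cl.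
have vit m : iter m (@ordS k.+3) i = ((i + m) %% k.+3)%N :> nat.
  elim: m => [|m IH] /=; first by rewrite addn0 modn_small.
  by rewrite IH -addn1 modnDml addn1 addnS.
suff -> : j = iter (j + k.+3 - i) (@ordS k.+3) i by rewrite it.
apply: val_inj; rewrite /= vit; have hi := ltn_ord i; have hj := ltn_ord j.
have -> : (i + (j + k.+3 - i) = j + k.+3)%N by lia.
by rewrite modnDr modn_small.
Qed.

(** Read [i] as the edge from i to i + 1 of a cycle: the right-hand set consists of the endpoints of
    the edges in [S]. A nonempty proper set of edges of a cycle is a union of paths, which has more
    vertices than edges. *)
Lemma card_ordS_hull (S : {set 'I_k.+3}) : S != set0 -> S != setT ->
  (#|S| < #|S :|: [set ordS i | i in S]|)%N.
Proof.
move=> /set0Pn[i iS] ST; apply: proper_card; rewrite properE subsetUl /=.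
apply: contra ST => /subsetP cl; apply/eqP; apply: (ordS_closed S i iS) => j jS.
by apply: cl; rewrite inE imset_f ?orbT.
Qed.

End CyclicSuccessor.

Lemma leq_overlap_bound (m a b N : nat) : (0 < m)%N -> (0 < N)%N ->
  (a < b)%N -> (b <= m)%N -> (m ^ b * N ^ (m - b) * N ^ a.+1 <= m ^ m * N ^ m)%N.
Proof.
move=> m0 N0 ab bm; rewrite -mulnA -expnD; apply: leq_mul; first exact: leq_pexp2l.
by apply: leq_pexp2l => //; lia.
Qed.

Section CyclesInGraphs.
Variables (n k : nat).
Local Notation tour := {ffun 'I_k.+3 -> 'I_n}.
Implicit Types f g : tour.

Definition tour_edge (f : tour) (i : 'I_k.+3) : {set 'I_n} := [set f i; f (ordS i)].

Definition tour_edges (f : tour) : {set {set 'I_n}} := [set tour_edge f i | i : 'I_k.+3].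

Lemma tour_edge_inj f : injective f -> injective (tour_edge f).
Proof.
move=> fi i j ij.
have : f i \in tour_edge f j by rewrite -ij !inE eqxx.
have : f (ordS i) \in tour_edge f j by rewrite -ij !inE eqxx orbT.
rewrite !inE !(inj_eq fi) => /orP[/eqP h1|/eqP /ordS_inj ->] // /orP[/eqP|/eqP h2] //.
by have := ordSS_neq k i; rewrite h1 -h2 eqxx.
Qed.

Lemma card_tour_edge f i : injective f -> #|tour_edge f i| = 2.
Proof. by move=> fi; rewrite cards2 (inj_eq fi) eq_sym ordS_neq. Qed.

Lemma card_tour_edges f : injective f -> #|tour_edges f| = k.+3.
Proof. by move=> fi; rewrite card_imset ?card_ord //; apply: tour_edge_inj. Qed.

Lemma tour_neighbour f i x y : injective f -> tour_edge f i = [set x; y] -> x != y ->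
  forall a, x = f a -> y \in [set f (ordS a); f (ord_pred a)].
Proof.
move=> fi e xy a xa.
have : x \in tour_edge f i by rewrite e !inE eqxx.
have : y \in tour_edge f i by rewrite e !inE eqxx orbT.
rewrite !inE xa !(inj_eq fi) => yi /orP[/eqP ai|/eqP ai]; move: yi xy; rewrite xa.
  by rewrite -ai => /orP[/eqP ->|->] //; rewrite eqxx.
by rewrite ai ordSK => /orP[->|/eqP ->]; rewrite ?orbT ?eqxx.
Qed.

Lemma tour_edge_image f g i : injective f -> tour_edge g i \in tour_edges f ->
  (g i \in f @: setT) && (g (ordS i) \in f @: setT).
Proof.
move=> fi /imsetP[j _ e].
have sub x : x \in tour_edge f j -> x \in f @: setT.
  by rewrite !inE => /orP[] /eqP ->; apply: imset_f; rewrite inE.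
by rewrite !sub // -e !inE eqxx ?orbT.
Qed.

Lemma card_tour_image f : (#|f @: setT| <= k.+3)%N.
Proof. by apply: leq_trans (leq_imset_card _ _) _; rewrite cardsT card_ord. Qed.

Definition common_edges f g : {set 'I_k.+3} := [set i | tour_edge g i \in tour_edges f].

(* A tour along the edges of the cycle [f] is determined by its first two vertices. *)
Lemma card_same_cycle f : injective f ->
  (#|[set g : tour | injectiveb g & common_edges f g == setT]| <= k.+3 ^ 2)%N.
Proof.
move=> fi; set A := [set _ | _ & _].
pose h g := (g ord0, g (ordS ord0)) : 'I_n * 'I_n.
have AP g : g \in A -> injective g /\ forall i, tour_edge g i \in tour_edges f.
  rewrite inE => /andP[/injectiveP gi /eqP gT]; split=> // i.
  by move: (in_setT i); rewrite -gT inE.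
have hinj : {in A &, injective h}.
  move=> g g' /AP[gi gE] /AP[gi' gE'] [h0 h1].
  (* The positions where both tours agree at two consecutive vertices; the first one belongs to [S],
     and [S] is closed under successor. *)
  pose S := [set i | (g i == g' i) && (g (ordS i) == g' (ordS i))].
  suff ST : S = setT.
    apply/ffunP => i; have : i \in S by rewrite ST inE.
    by rewrite inE => /andP[/eqP].
  apply: (ordS_closed k S ord0) => [|j]; first by rewrite inE h0 h1 !eqxx.
  rewrite !inE => /andP[/eqP e0 /eqP e1]; rewrite e1 eqxx /=.
  have /andP[_ /imsetP[a _ xa]] := tour_edge_image f g j fi (gE j).
  have Jne (u : tour) v : injective u -> u (ordS v) != u v :> 'I_n by move=> ui; rewrite (inj_eq ui) ordS_neq.
  have JJne (u : tour) v : injective u -> u v != u (ordS (ordS v)) :> 'I_n.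
    by move=> ui; rewrite (inj_eq ui) eq_sym ordSS_neq.
  have [i0 _ i0E] := imsetP (gE j); have [i1 _ i1E] := imsetP (gE (ordS j)).
  have [i2 _ i2E] := imsetP (gE' (ordS j)).
  have y0 : g j \in [set f (ordS a); f (ord_pred a)].
    apply: (tour_neighbour f i0 _ _ fi _ (Jne g j gi) a xa).
    by rewrite -i0E /tour_edge setUC.
  have y1 : g (ordS (ordS j)) \in [set f (ordS a); f (ord_pred a)].
    by apply: (tour_neighbour f i1 _ _ fi (esym i1E) _ a xa); rewrite eq_sym Jne.
  have y2 : g' (ordS (ordS j)) \in [set f (ordS a); f (ord_pred a)].
    apply: (tour_neighbour f i2 _ _ fi (esym i2E) _ a); last by rewrite -e1.
    by rewrite eq_sym Jne.
  (* The vertices of [g] and [g'] at position j + 2 are neighbours on [f] of the vertex at position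
     j + 1, and both differ from [g j], which is one of its only two neighbours; so they
     coincide. *)
  have := JJne g j gi; have := JJne g' j gi'; rewrite -e0; move: y0 y1 y2.
  rewrite !inE => /orP[] /eqP -> /orP[] /eqP -> /orP[] /eqP -> //; rewrite ?eqxx //.
rewrite -(card_in_imset hinj); apply: leq_trans (_ : #|setX (f @: setT) (f @: setT)| <= _)%N.
  apply: subset_leq_card; apply/subsetP => _ /imsetP[g /AP[gi gE] ->].
  by rewrite in_setX; apply: tour_edge_image.
by rewrite cardsX leq_mul ?card_tour_image.
Qed.

(** At the endpoints [I] of the shared edges, [g] takes one of the at most k + 3 vertices of [f],
    and elsewhere one of n. As [I] has more elements than [S], this saves an extra factor n. *)
Lemma card_partial_overlap f (S : {set 'I_k.+3}) : injective f -> (0 < n)%N ->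
  S != set0 -> S != setT ->
  (#|[set g : tour | common_edges f g == S]| * n ^ #|S|.+1 <= k.+3 ^ k.+3 * n ^ k.+3)%N.
Proof.
move=> fi n0 S0 ST; set I := S :|: [set ordS i | i in S].
have SI := card_ordS_hull k S S0 ST; rewrite -/I in SI.
have Ik : (#|I| <= k.+3)%N by rewrite -[leqRHS](card_ord k.+3) max_card.
pose P i : pred 'I_n := [pred x | (i \in I) ==> (x \in f @: setT)].
have cP : #|family P| = (#|f @: setT| ^ #|I| * n ^ (k.+3 - #|I|))%N.
  rewrite card_family foldrE big_image /= (bigID (mem I)) /=; congr (_ * _)%N.
    rewrite (eq_bigr (fun=> #|f @: setT|)) ?prod_nat_const // => i iI.
    by apply: eq_card => x; rewrite inE iI.
  rewrite (eq_bigr (fun=> n)); last first.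
    move=> i /negbTE iI; rewrite -[RHS](card_ord n); apply: eq_card => x.
    by rewrite inE iI.
  rewrite prod_nat_const; congr (_ ^ _)%N; rewrite -[X in (X - _)%N](card_ord k.+3) -(cardC (mem I)).
  by rewrite addKn; apply: eq_card => i; rewrite !inE.
have le : (#|[set g : tour | common_edges f g == S]| <= k.+3 ^ #|I| * n ^ (k.+3 - #|I|))%N.
  apply: leq_trans (_ : #|family P| <= _)%N; last first.
    rewrite cP leq_mul2r leq_exp2r ?orbT //; last by apply: leq_ltn_trans SI.
    by rewrite card_tour_image orbT.
  apply: subset_leq_card; apply/subsetP => g; rewrite inE => /eqP gS.
  apply/familyP => i; rewrite inE; apply/implyP; rewrite inE => /orP[|/imsetP[j]]; rewrite -gS inE.
    by case/(tour_edge_image f g _ fi)/andP.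
  by case/(tour_edge_image f g _ fi)/andP => _ + ->.
apply: leq_trans (leq_mul le (leqnn _)) _.
exact: leq_overlap_bound.
Qed.

(** The cycle is the sum of the edges oriented along the tour; [eps] compares that direction with
    the order of the vertices. *)
Lemma tour_has_cycle (K : fieldType) (F : {set {set 'I_n}}) f : injective f ->
  tour_edges f \subset F -> has_cycle K n F.
Proof.
move=> fi /subsetP fF; pose eps i : K := (-1) ^+ (f i < f (ordS i))%N.
pose c t := \sum_i (t == tour_edge f i)%:R * eps i; exists c; split.
- exists (tour_edge f ord0); rewrite /c (bigD1 ord0) //= eqxx mul1r big1.
    by rewrite addr0 signr_eq0.
  by move=> j j0; rewrite (inj_eq (tour_edge_inj f fi)) eq_sym (negbTE j0) mul0r.
- move=> t; apply: contraNT => tF; rewrite /c big1 // => i _.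
  by case: eqP tF => [-> /negP[]|]; rewrite ?mul0r //; apply/fF/imset_f.
move=> s; rewrite /c.
under eq_bigr => v _ do rewrite mulr_sumr.
rewrite exchange_big /=.
(* Edge i contributes its start minus its end, so the boundary telescopes around the tour. *)
have edge i : \sum_(v | v \notin s) (-1) ^+ incidence_sign n s v *
    ((v |: s == tour_edge f i)%:R * eps i) =
    (s == [set f i])%:R - (s == [set f (ordS i)])%:R.
  set a := f i; set b := f (ordS i).
  have ab : a != b by rewrite (inj_eq fi) eq_sym ordS_neq.
  have sgn x y : incidence_sign n [set x] y = (x < y)%N.
    rewrite /incidence_sign; have [xy|xy] := boolP (x < y)%N.
      rewrite (_ : [set u in [set x] | _] = [set x]) ?cards1 //.
      by apply/setP => u; rewrite !inE; case: eqP => // ->.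
    rewrite (_ : [set u in [set x] | _] = set0) ?cards0 //.
    by apply/setP => u; rewrite !inE; case: eqP => // ->; rewrite (negbTE xy).
  have char v : v \notin s -> (v |: s == [set a; b]) =
      ((v == a) && (s == [set b])) || ((v == b) && (s == [set a])).
    move=> vs; apply/eqP/orP => [e|[] /andP[/eqP -> /eqP ->]] //; last by rewrite setUC.
    have sE : s = [set a; b] :\ v by rewrite -e setU1K.
    have : v \in [set a; b] by rewrite -e setU11.
    rewrite !inE => /orP[] /eqP va; [left|right]; rewrite va eqxx /= sE va; apply/eqP.
      by rewrite setU1K // inE.
    by rewrite setUC setU1K // inE eq_sym.
  rewrite (eq_bigr (fun v => ((v == a) && (s == [set b]))%:R *
      ((-1) ^+ (b < a)%N * eps i) + ((v == b) && (s == [set a]))%:R *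
      ((-1) ^+ (a < b)%N * eps i))); last first.
    move=> v vs; rewrite mulrCA /tour_edge -/a -/b char //.
    case: (v =P a) => [->|_]; rewrite ?(negbTE ab) /=.
      by rewrite orbF mul0r addr0; case: (s =P [set b]) => [->|]; rewrite ?mul0r // sgn.
    case: (v =P b) => [->|_] /=; last by rewrite !mul0r addr0.
    by rewrite mul0r add0r; case: (s =P [set a]) => [->|]; rewrite ?mul0r // sgn.
  have collapse x y (z : K) : x != y ->
      \sum_(v | v \notin s) ((v == x) && (s == [set y]))%:R * z = (s == [set y])%:R * z.
    move=> xy; case: (s =P [set y]) => [->|_]; last first.
      by rewrite big1 ?mul0r // => v _; rewrite andbF mul0r.
    rewrite (bigD1 x) ?inE //= eqxx big1 ?addr0 // => v /andP[_ /negbTE ->].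
    by rewrite mul0r.
  rewrite big_split /= !collapse //; last by rewrite eq_sym.
  rewrite /eps -/a -/b -!signr_addb; case: (ltngtP a b) => h; last 1 first.
  - by case/eqP: ab; apply: val_inj.
  - by rewrite expr0 expr1 mulr1 mulrN1 addrC.
  - by rewrite expr0 expr1 mulr1 mulrN1 addrC.
rewrite (eq_bigr _ (fun i _ => edge i)) sumrB.
by rewrite [X in X - _](reindex_inj (@ordS_inj k.+3)) subrr.
Qed.

(** * The second moment of the number of tours *)

Variables (R : realFieldType) (p : R).
Hypothesis p01 : 0 <= p <= 1.
Local Notation E := (expect R _ (face_prob R n 1 p)).

Lemma expect_subset (A : {set {set 'I_n}}) : (forall t, t \in A -> #|t| = 2) ->
  E (fun F => (A \subset F)%:R) = p ^+ #|A|.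
Proof.
move=> A2; rewrite (eq_expect _ _ _ _ (fun F => \prod_(t <- enum A) (t \in F)%:R)).
  rewrite expect_contain ?enum_uniq // big_enum /= -prodr_const.
  by apply: eq_bigr => t tA; rewrite /face_prob A2 ?eqxx.
move=> F; have [/subsetP AF|/subsetPn[t tA tF]] := boolP (A \subset F).
  by rewrite big_seq big1 // => t; rewrite mem_enum => /AF ->.
by rewrite (big_rem t) ?mem_enum //= (negbTE tF) mul0r.
Qed.

(** Each cycle of length k + 3 is counted once for every starting point and direction. *)
Definition tour_count (F : {set {set 'I_n}}) : R :=
  \sum_(f : tour | injectiveb f) (tour_edges f \subset F)%:R.

Lemma tour_edges_card2 f t : injective f -> t \in tour_edges f -> #|t| = 2.
Proof. by move=> fi /imsetP[i _ ->]; rewrite card_tour_edge. Qed.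

Lemma card_injections : #|[pred f : tour | injectiveb f]| = n ^_ k.+3.
Proof.
have := card_inj_ffuns 'I_k.+3 'I_n; rewrite !card_ord => <-.
by apply: eq_card => f; rewrite !inE.
Qed.

Lemma expect_tour_count : E tour_count = (n ^_ k.+3)%:R * p ^+ k.+3.
Proof.
rewrite /tour_count expect_sum (eq_bigr (fun=> p ^+ k.+3)).
  by rewrite sumr_const card_injections mulr_natl.
move=> f /injectiveP fi; rewrite expect_subset ?card_tour_edges //.
by move=> t; apply: tour_edges_card2.
Qed.

Lemma card_tour_edgesU f g : injective f -> injective g ->
  #|tour_edges f :|: tour_edges g| = (k.+3 + (k.+3 - #|common_edges f g|))%N.
Proof.
move=> fi gi; rewrite cardsU !card_tour_edges // addnBA; last first.
  by rewrite -[leqRHS](card_ord k.+3) max_card.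
congr (_ - _)%N; rewrite -(card_imset _ (tour_edge_inj g gi)); apply: eq_card => t.
rewrite inE andbC; apply/andP/imsetP => [[/imsetP[i _ ->] tf]|[i]].
  by exists i; rewrite ?inE.
by rewrite inE => h ->; split=> //; apply/imset_f.
Qed.

(** Classify [g] by the positions of the edges it shares with [f]. The three terms come from no
    shared edge, from all edges shared, and from the at most 2^(k+3) partial overlaps, each of order
    1/n by [card_partial_overlap]. *)
Lemma overlap_sum_le f (c : R) : injective f -> (0 < n)%N -> 1 <= c -> n%:R * p = c ->
  \sum_(g : tour | injectiveb g) p ^+ (k.+3 - #|common_edges f g|) <=
  c ^+ k.+3 + (k.+3 ^ 2)%:R + (2 ^ k.+3 * k.+3 ^ k.+3)%:R * c ^+ k.+3 / n%:R.
Proof.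
move=> fi n0 c1 npc; set m := k.+3.
have /andP[p0 p1] := p01.
have n0R : 0 < n%:R :> R by rewrite ltr0n.
pose N (S : {set 'I_m}) := #|[pred g : tour | injectiveb g & common_edges f g == S]|.
rewrite (partition_big (common_edges f) xpredT) //=.
have NE S : \sum_(g : tour | injectiveb g && (common_edges f g == S))
    p ^+ (m - #|common_edges f g|) = (N S)%:R * p ^+ (m - #|S|).
  rewrite (eq_bigr (fun=> p ^+ (m - #|S|))); last by move=> g /andP[_ /eqP ->].
  by rewrite sumr_const mulr_natl.
rewrite (eq_bigr _ (fun S _ => NE S)) (bigD1 set0) //= (bigD1 setT) /=; last first.
  by apply/negP => /eqP/setP/(_ ord0); rewrite !inE.
rewrite addrA; apply: lerD; first apply: lerD.
- rewrite cards0 subn0 -npc exprMn ler_wpM2r ?exprn_ge0 // -natrX ler_nat.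
  apply: leq_trans (max_card _) _; by rewrite card_ffun !card_ord.
- rewrite cardsT card_ord subnn expr0 mulr1 ler_nat.
  apply: leq_trans (card_same_cycle f fi); rewrite subset_leq_card //.
  by apply/subsetP => g; rewrite !inE.
have each S : S != setT -> S != set0 ->
    (N S)%:R * p ^+ (m - #|S|) <= (m ^ m)%:R * c ^+ m / n%:R.
  move=> ST S0; rewrite ler_pdivlMr //.
  have Sm : (#|S| <= m)%N by rewrite -[leqRHS](card_ord m) max_card.
  have NS : ((N S) * n ^ #|S|.+1 <= m ^ m * n ^ m)%N.
    apply: leq_trans (card_partial_overlap f S fi n0 S0 ST); rewrite leq_mul2r.
    rewrite subset_leq_card ?orbT //.
    by apply/subsetP => g; rewrite !inE => /andP[].
  have NSR : (N S)%:R * n%:R ^+ #|S|.+1 <= (m ^ m)%:R * n%:R ^+ m :> R.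
    by rewrite -!natrX -!natrM ler_nat.
  have cS : p ^+ (m - #|S|) * n%:R ^+ m = c ^+ (m - #|S|) * n%:R ^+ #|S|.
    have -> : n%:R ^+ m = n%:R ^+ (m - #|S|) * n%:R ^+ #|S| :> R by rewrite -exprD subnK.
    by rewrite -npc exprMn; ring.
  rewrite -(ler_pM2r (exprn_gt0 #|S| n0R)).
  have -> : (N S)%:R * p ^+ (m - #|S|) * n%:R * n%:R ^+ #|S| =
     (N S)%:R * n%:R ^+ #|S|.+1 * p ^+ (m - #|S|) by rewrite exprS; ring.
  apply: le_trans (ler_wpM2r (exprn_ge0 _ p0) NSR) _.
  rewrite -mulrA [_ ^+ m * p ^+ _]mulrC cS mulrA ler_wpM2r ?exprn_ge0 ?ler0n //.
  by rewrite ler_wpM2l ?exprn_ge0 ?ler0n // ler_weXn2l // leq_subr.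
apply: le_trans (_ : \sum_(S : {set 'I_m}) (m ^ m)%:R * c ^+ m / n%:R <= _).
  rewrite [leRHS](bigID (fun S : {set 'I_m} => (S != set0) && (S != setT))) /=.
  rewrite ler_wpDr //.
    have c0 : 0 <= c ^+ m by rewrite exprn_ge0 ?(le_trans ler01).
    by apply: sumr_ge0 => S _; rewrite divr_ge0 ?ler0n // mulr_ge0 ?ler0n.
  by apply: ler_sum => S /andP[S0 ST]; apply: each.
have c2 : #|{set 'I_m}| = (2 ^ m)%N.
  by rewrite -cardsT -powersetT card_powerset cardsT card_ord.
rewrite sumr_const c2.
have -> : (2 ^ m * m ^ m)%:R = (2 ^ m)%:R * (m ^ m)%:R :> R by apply: natrM.
have assoc q (y z t : R) : (y * z / t) *+ q <= q%:R * y * z / t.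
  by rewrite -[leLHS]mulr_natl !mulrA.
exact: assoc.
Qed.

(** With mean [m], the probability of no tour times m^2 is at most the variance, which is at most
    m(B - m) because the second moment is at most mB; one factor [m] cancels. *)
Lemma no_tour_prob (c : R) : (k.+3 <= n)%N -> 1 <= c -> n%:R * p = c ->
  E (fun F => (tour_count F == 0)%R%:R) * ((n ^_ k.+3)%:R * p ^+ k.+3) <=
  c ^+ k.+3 + (k.+3 ^ 2)%:R + (2 ^ k.+3 * k.+3 ^ k.+3)%:R * c ^+ k.+3 / n%:R -
  (n ^_ k.+3)%:R * p ^+ k.+3.
Proof.
move=> kn c1 npc; set m := (n ^_ k.+3)%:R * _; set B := _ + _ / _.
have n0 : (0 < n)%N by apply: leq_trans kn.
have n0R : 0 < n%:R :> R by rewrite ltr0n.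
have p0 : 0 < p by rewrite -(pmulr_rgt0 _ n0R) npc (lt_le_trans ltr01).
have m0 : 0 < m by rewrite mulr_gt0 ?exprn_gt0 // ltr0n ffact_gt0.
have second : E (fun F => tour_count F ^+ 2) <= m * B.
  rewrite (eq_expect _ _ _ _ (fun F => \sum_(f : tour | injectiveb f)
      \sum_(g : tour | injectiveb g) (tour_edges f :|: tour_edges g \subset F)%:R)).
    rewrite expect_sum (eq_bigr (fun f : tour => p ^+ k.+3 *
       \sum_(g : tour | injectiveb g) p ^+ (k.+3 - #|common_edges f g|))).
      apply: le_trans (_ : \sum_(f : tour | injectiveb f) p ^+ k.+3 * B <= _).
        apply: ler_sum => f /injectiveP fi; rewrite ler_wpM2l ?exprn_ge0 ?(ltW p0) //.
        exact: overlap_sum_le.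
      by rewrite sumr_const card_injections -mulr_natl /m mulrA.
    move=> f /injectiveP fi; rewrite expect_sum mulr_sumr; apply: eq_bigr => g /injectiveP gi.
    rewrite expect_subset ?card_tour_edgesU ?exprD // => t.
    by rewrite inE => /orP[]; apply: tour_edges_card2.
  move=> F; rewrite expr2 mulr_suml; apply: eq_bigr => f _; rewrite mulr_sumr.
  by apply: eq_bigr => g _; rewrite -natrM mulnb subUset.
have h1 : m ^+ 2 * E (fun F => (tour_count F == 0)%R%:R) <=
    E (fun F => (tour_count F - m) ^+ 2).
  rewrite -expectZ; apply: expect_le; first exact: face_prob01.
  move=> F; case: eqP => [->|_]; last by rewrite mulr0 sqr_ge0.
  by rewrite mulr1 sub0r sqrrN.
have h2 : E (fun F => (tour_count F - m) ^+ 2) = E (fun F => tour_count F ^+ 2) - m ^+ 2.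
  rewrite (eq_expect _ _ _ _ (fun F => tour_count F ^+ 2 + ((- m *+ 2) * tour_count F + m ^+ 2))).
    by rewrite expectD expectD expectZ expect_const expect_tour_count -/m; ring.
  by move=> F; ring.
rewrite -(ler_pM2l m0); apply: le_trans (_ : m ^+ 2 * E (fun F => (tour_count F == 0)%R%:R) <= _).
  by rewrite le_eqVlt; apply/orP; left; apply/eqP; ring.
apply: le_trans h1 _; rewrite h2 mulrBr expr2 lerB //.
Qed.

Lemma tour_count_neq0_has_cycle (K : fieldType) F : tour_count F != 0 -> has_cycle K n F.
Proof.
have [/existsP[f /andP[/injectiveP fi fF]] _|none] :=
    boolP [exists f : tour, injectiveb f && (tour_edges f \subset F)].
  exact: tour_has_cycle fi fF.
rewrite /tour_count big1 ?eqxx // => f fi; move: none; rewrite negb_exists.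
by move/forallP/(_ f); rewrite fi /= => /negbTE ->.
Qed.

End CyclesInGraphs.

(** * Asymptotics *)

(* The standard library binds [R_scope] to these arguments. *)
Local Arguments Un_cv _ _%_ring_scope.
Local Arguments exp _%_ring_scope.

Lemma Un_cvP (u : nat -> R) (l : R) :
  Un_cv u l <-> forall e : R, 0 < e -> exists N, forall n, (N <= n)%N -> `|u n - l| < e.
Proof.
split=> h e e0.
  have /RltP e0' := e0; have [N hN] := h e e0'; exists N => n Nn.
  by have /RltP := hN n (ssrnat.leP Nn); rewrite RdistE.
have [|N hN] := h e; [exact/RltP | exists N => n Nn].
by apply/RltP; rewrite RdistE; apply/hN/ssrnat.leP.
Qed.

Lemma cvB (u v : nat -> R) (a b : R) : Un_cv u a -> Un_cv v b ->
  Un_cv (fun n => u n - v n) (a - b).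
Proof. exact: CV_minus. Qed.

Lemma cvM (u v : nat -> R) (a b : R) : Un_cv u a -> Un_cv v b ->
  Un_cv (fun n => u n * v n) (a * b).
Proof. exact: CV_mult. Qed.

Lemma cv_const (a : R) : Un_cv (fun=> a) a.
Proof. by apply/Un_cvP => e e0; exists 0%N => n _; rewrite subrr normr0. Qed.

Lemma cvX (u : nat -> R) (a : R) k : Un_cv u a -> Un_cv (fun n => u n ^+ k) (a ^+ k).
Proof.
move=> ua; elim: k => [|k IH]; first exact: cv_const.
apply: (Un_cv_ext (fun n => u n * u n ^+ k)); first by move=> n; rewrite exprS.
by rewrite exprS; apply: cvM.
Qed.

Lemma cv_exp (u : nat -> R) (a : R) : Un_cv u a -> Un_cv (fun n => exp (u n)) (exp a).
Proof. by apply: continuity_seq; apply/derivable_continuous_pt/derivable_pt_exp. Qed.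

Lemma cv_squeeze (u v w : nat -> R) (l : R) N :
  (forall n, (N <= n)%N -> u n <= v n <= w n) -> Un_cv u l -> Un_cv w l -> Un_cv v l.
Proof.
move=> h /Un_cvP hu /Un_cvP hw; apply/Un_cvP => e e0.
have [N1 h1] := hu e e0; have [N2 h2] := hw e e0.
exists (N + N1 + N2)%N => n Nn.
have /andP[a b] : u n <= v n <= w n by apply: h; lia.
have c1 : `|u n - l| < e by apply: h1; lia.
have c2 : `|w n - l| < e by apply: h2; lia.
move: c1 c2; rewrite !ltr_norml => /andP[? ?] /andP[? ?]; apply/andP; split; lra.
Qed.

Lemma cv_inv (a : R) : Un_cv (fun n => a / n%:R) 0.
Proof.
apply/Un_cvP => e e0; pose b := Num.bound (`|a| / e).
have hb : `|a| / e < b%:R by apply: archi_boundP; rewrite divr_ge0 ?(ltW e0) ?normr_ge0.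
exists b.+1 => n bn; have n0 : 0 < n%:R :> R by rewrite ltr0n; lia.
rewrite subr0 normrM normfV (ger0_norm (ltW n0)) ltr_pdivrMr //.
rewrite ltr_pdivrMr // mulrC in hb; apply: lt_le_trans hb _.
by rewrite ler_wpM2l ?(ltW e0) // ler_nat ltnW.
Qed.

Lemma cv_mean (c : R) (j : nat) : Un_cv (fun n => (n - j)%:R * (c / n%:R)) c.
Proof.
have h : Un_cv (fun n => c - (j%:R * c) / n%:R) (c - 0).
  by apply: cvB; [exact: cv_const | exact: cv_inv].
rewrite subr0 in h; apply: (cv_squeeze _ _ _ _ j.+1 _ h h) => n jn.
suff -> : (n - j)%:R * (c / n%:R) = c - (j%:R * c) / n%:R by rewrite lexx.
have n0 : n%:R != 0 :> R by rewrite pnatr_eq0; lia.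
rewrite natrB; last by lia.
by field.
Qed.

Lemma expMn (x : R) m : exp x ^+ m = exp (m%:R * x).
Proof.
elim: m => [|m IH]; first by rewrite expr0 mul0r exp_0.
by rewrite exprS IH -RmultE -exp_plus RplusE mulrS mulrDl mul1r.
Qed.

Lemma exp_ge1D (x : R) : 1 + x <= exp x.
Proof. by apply/RleP; apply: exp_ineq1_le. Qed.

Lemma exp_gt0 (x : R) : 0 < exp x.
Proof. by apply/RltP; apply: exp_pos. Qed.

(** With p = c/n and q = p/(1 - p), one has exp(-q) <= 1 - p <= exp(-p), the left inequality because
    1 - p = 1/(1 + q). Both (n - j)p and (n - j)q tend to [c]. *)
Lemma cv_pow_exp (c : R) (j : nat) : 0 < c ->
  Un_cv (fun n => (1 - c / n%:R) ^+ (n - j)) (exp (- c)).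
Proof.
move=> c0; pose b := Num.bound c.
have hb : c < b%:R by apply: archi_boundP; rewrite ltW.
pose q n := (c / n%:R) / (1 - c / n%:R).
apply: (cv_squeeze (fun n => exp (- ((n - j)%:R * q n))) _
                   (fun n => exp (- ((n - j)%:R * (c / n%:R)))) _ b.+1).
- move=> n bn; have n0 : 0 < n%:R :> R by rewrite ltr0n; lia.
  have p1 : c / n%:R < 1.
    rewrite ltr_pdivrMr // mul1r; apply: lt_trans hb _; rewrite ltr_nat; lia.
  have p0 : 0 < c / n%:R by rewrite divr_gt0.
  have p1' : 0 <= 1 - c / n%:R by rewrite subr_ge0 ltW.
  rewrite -(mulrN _ (q n)) -(mulrN _ (c / n%:R)) -!expMn.
  apply/andP; split; rewrite lerXn2r ?nnegrE ?(ltW (exp_gt0 _)) //.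
    have q1 : 1 - c / n%:R = (1 + q n)^-1.
      have r0 : 1 - c / n%:R != 0 by rewrite gt_eqF // subr_gt0.
      suff -> : 1 + q n = (1 - c / n%:R)^-1 by rewrite invrK.
      by rewrite /q -{1}(divff r0) -mulrDl subrK mul1r.
    have eq0 : exp (- q n) = (exp (q n))^-1 by rewrite -RoppE exp_Ropp.
    have q0 : 0 <= q n by apply: divr_ge0; [exact: ltW | rewrite subr_ge0 ltW].
    by rewrite q1 eq0 lef_pV2 ?posrE ?exp_gt0 ?exp_ge1D // ltr_pwDl.
  by have := exp_ge1D (- (c / n%:R)).
- apply: cv_exp; rewrite -(mulN1r c); apply: (Un_cv_ext (fun n => -1 * ((n - j)%:R * q n))).
    by move=> n; rewrite mulN1r.
  apply: cvM; first exact: cv_const.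
  have hq : Un_cv (fun n => (n - j)%:R * (c / n%:R) * (1 - c / n%:R)^-1) (c * (1 - 0)^-1).
    apply: cvM; first exact: cv_mean.
    have := continuity_seq (fun x => Rinv x) (fun n => 1 - c / n%:R) (1 - 0)%R.
    apply; last by apply: cvB; [exact: cv_const | exact: cv_inv].
    rewrite subr0; apply: (continuity_pt_inv id); last exact: R1_neq_R0.
    exact: derivable_continuous_pt (derivable_pt_id _).
  rewrite subr0 invr1 mulr1 in hq.
  by apply: Un_cv_ext hq => n; rewrite /q !mulrA.
- apply: cv_exp; rewrite -(mulN1r c); apply: (Un_cv_ext (fun n => -1 * ((n - j)%:R * (c / n%:R)))).
    by move=> n; rewrite mulN1r.
  by apply: cvM; [exact: cv_const | exact: cv_mean].
Qed.

Lemma bernoulli (x : R) k : 0 <= x <= 1 -> 1 - k%:R * x <= (1 - x) ^+ k.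
Proof.
move=> /andP[x0 x1]; elim: k => [|k IH]; first by rewrite mul0r subr0 expr0.
have h : (1 - x) * (1 - k%:R * x) <= (1 - x) * (1 - x) ^+ k by rewrite ler_wpM2l ?subr_ge0.
rewrite exprS; apply: le_trans h; rewrite -subr_ge0 mulrS.
have -> : (1 - x) * (1 - k%:R * x) - (1 - (1 + k%:R) * x) = k%:R * (x * x) by ring.
by rewrite mulr_ge0 ?ler0n ?mulr_ge0.
Qed.

Lemma g_funE d (x : R) : g_fun d x =
  d.+1%:R * (x + 1) * exp (- x) + x * (1 - exp (- x)) ^+ d.+1.
Proof. by rewrite /g_fun INRE RpowE. Qed.

(* Above [cd] the function [g_fun d] cannot cross the level [d + 1] again, and it
   tends to infinity. *)
Lemma g_fun_gt (d : nat) (cd c : R) : (1 < d)%N -> is_c d cd -> 0 < c -> cd < c ->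
  c < d.+1%:R -> d.+1%:R < g_fun d c.
Proof.
move=> d1 [[d1' _]|[_ [cd0 [_ uniq]]]] c0 cdc cd1; first by rewrite d1' in d1.
rewrite ltNge; apply/negP => le.
have gc : g_fun d c != d.+1%:R.
  apply/eqP => e; have ccd : c = cd by apply: uniq; [exact/RltP | rewrite INRE].
  by rewrite ccd ltxx in cdc.
have lt : g_fun d c < d.+1%:R by rewrite lt_neqAle gc.
(* Since X exp(-X) <= 1, Bernoulli's inequality gives g_d(X) >= X - (d+1), so 2(d+1) + 1 is large
   enough. *)
pose X : R := (d.+1 + d.+1 + 1)%:R.
have cX : c < X by apply: lt_trans cd1 _; rewrite ltr_nat; lia.
have X0 : 0 < X by rewrite ltr0n.
have gX : d.+1%:R < g_fun d X.
  rewrite g_funE; have eX := exp_gt0 (- X).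
  have eX1 : exp (- X) * (1 + X) <= 1.
    have := exp_ge1D X; rewrite -(ler_pM2l eX) => h; apply: le_trans h _.
    by rewrite -RmultE -exp_plus RplusE addNr exp_0.
  have eXX : X * exp (- X) <= 1 by move: eX1; rewrite mulrDr mulr1 mulrC; lra.
  have e1 : 0 <= exp (- X) <= 1.
    by rewrite ltW //=; apply: le_trans _ eX1; rewrite ler_peMr ?ltW //; lra.
  have h1 := bernoulli _ d.+1 e1.
  have h2 : X * (1 - d.+1%:R * exp (- X)) <= X * (1 - exp (- X)) ^+ d.+1.
    by rewrite ler_wpM2l // ltW.
  have h3 : d.+1%:R * (X * exp (- X)) <= d.+1%:R * 1 by rewrite ler_wpM2l ?ler0n.
  have h4 : 0 <= d.+1%:R * (X + 1) * exp (- X).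
    by rewrite mulr_ge0 ?(ltW eX) // mulr_ge0 ?ler0n //; lra.
  have XE : X = d.+1%:R + d.+1%:R + 1 by rewrite /X !natrD.
  have h5 : X * (1 - d.+1%:R * exp (- X)) = X - d.+1%:R * (X * exp (- X)) by ring.
  lra.
have cont : continuity (fun x => Rminus (g_fun d x) (INR d.+1)).
  by rewrite /g_fun; reg.
have [|||z [zc zE]] := IVT (fun x => Rminus (g_fun d x) (INR d.+1)) c X cont.
- exact/RltP.
- by apply/RltP; rewrite INRE RminusE subr_lt0.
- by apply/RltP; rewrite INRE RminusE subr_gt0.
have [/RleP zc1 _] := zc.
have zcd : z = cd.
  apply: uniq; first by apply/RltP; apply: lt_le_trans zc1.
  by apply/eqP; rewrite -subr_eq0; apply/eqP.
by move: zc1; rewrite zcd leNgt cdc.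
Qed.

Lemma bin_large (d : nat) (B : R) : (0 < d)%N ->
  exists N, forall n, (N <= n)%N -> (d < n)%N /\ B < 'C(n, d)%:R.
Proof.
case: d => // d _; pose b := Num.bound `|B|.
have hb : `|B| < b%:R by apply: archi_boundP; rewrite normr_ge0.
exists (d.+2 + d.+1 * b)%N => n Nn; split; first by lia.
apply: le_lt_trans (ler_norm B) (lt_le_trans hb _); rewrite ler_nat.
have := mul_bin_left n d; have : (0 < 'C(n, d))%N by rewrite bin_gt0; lia.
nia.
Qed.

(** Both Chebyshev bounds have this form with b = C(n, d): a variance bound of order b against a
    squared deviation of order b^2 leaves a quantity of order 1/b. *)
Lemma ratio_small (x y a s b e : R) : 0 < e -> 0 < s -> 0 < b -> x <= b * a ->
  b * s <= y -> a / s ^+ 2 / e < b -> x * (1 / y) ^+ 2 < e.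
Proof.
move=> e0 s0 b0 xa bs ab.
have y0 : 0 < y by apply: lt_le_trans bs; rewrite mulr_gt0.
rewrite expr_div_n expr1n mulrA mulr1 ltr_pdivrMr ?exprn_gt0 //.
apply: le_lt_trans xa _; apply: lt_le_trans (_ : e * (b * s) ^+ 2 <= _); last first.
  by rewrite ler_pM2l // lerXn2r // nnegrE ltW // mulr_gt0.
rewrite ltr_pdivrMr // ltr_pdivrMr ?exprn_gt0 // in ab.
have -> : e * (b * s) ^+ 2 = b * (b * e * s ^+ 2) by ring.
by rewrite ltr_pM2l.
Qed.

Lemma binS_prob (n d : nat) (c : R) : 'C(n, d.+1)%:R * (c / n%:R) =
  'C(n, d)%:R * ((n - d)%:R * (c / n%:R) / d.+1%:R).
Proof.
have h : d.+1%:R * 'C(n, d.+1)%:R = (n - d)%:R * 'C(n, d)%:R :> R.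
  by rewrite -!natrM mul_bin_left.
have d0 : d.+1%:R != 0 :> R by rewrite pnatr_eq0.
have -> : 'C(n, d.+1)%:R = (n - d)%:R * 'C(n, d)%:R / d.+1%:R :> R.
  by rewrite -h mulrAC divff ?mul1r.
ring.
Qed.

Lemma binS_prob_le (n d : nat) (c : R) : 0 < c -> (0 < n)%N ->
  'C(n, d.+1)%:R * (c / n%:R) <= 'C(n, d)%:R * (c / d.+1%:R).
Proof.
move=> c0 n0; rewrite binS_prob ler_wpM2l ?ler0n // ler_wpM2r ?invr_ge0 ?ler0n //.
have n0R : 0 < n%:R :> R by rewrite ltr0n.
by rewrite mulrA ler_pdivrMr // [leLHS]mulrC ler_wpM2l ?(ltW c0) // ler_nat leq_subr.
Qed.

Lemma edge_prob01 (n : nat) (c : R) (b : nat) : 0 < c -> c < b%:R -> (b <= n)%N ->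
  0 <= c / n%:R <= 1.
Proof.
move=> c0 cb bn; have n0 : 0 < n%:R :> R by apply: lt_le_trans (lt_trans c0 cb) _; rewrite ler_nat.
apply/andP; split; first by apply: divr_ge0; apply: ltW.
rewrite ler_pdivrMr // mul1r; apply: le_trans (ltW cb) _.
by rewrite ler_nat.
Qed.

Lemma geq_sum3 (a b c n : nat) : (a + b + c <= n)%N -> [/\ (a <= n)%N, (b <= n)%N & (c <= n)%N].
Proof. by split; lia. Qed.

(** * The exceptional events have small probability *)

Lemma many_faces_small (d : nat) (c e : R) : (0 < d)%N -> 0 < c -> c < d.+1%:R -> 0 < e ->
  exists N, forall n, (N <= n)%N ->
  expect R _ (face_prob R n d (c / n%:R)) (fun F => ('C(n, d) <= #|F|)%N%:R) < e.
Proof.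
move=> d0 c0 cd e0; pose a := c / d.+1%:R.
have d0R : 0 < d.+1%:R :> R by rewrite ltr0n.
have a1 : a < 1 by rewrite ltr_pdivrMr // mul1r.
have [N hN] := bin_large d (`|a / (1 - a) ^+ 2 / e|) d0.
exists (N + 0 + d.+1)%N => n /geq_sum3[Nn _ dn]; have [_ big] := hN n Nn.
have p01 : 0 <= c / n%:R <= 1 by apply: (edge_prob01 n c d.+1).
have b0 : 0 < 'C(n, d)%:R :> R by apply: le_lt_trans big.
have xle : 'C(n, d.+1)%:R * (c / n%:R) <= 'C(n, d)%:R * a.
  exact: binS_prob_le (leq_trans (ltn0Sn d) dn).
apply: le_lt_trans (many_faces_prob R n d _ p01 _) _.
  by apply: le_lt_trans xle _; rewrite gtr_pMr.
apply: (ratio_small _ _ a (1 - a) 'C(n, d)%:R) => //; first by rewrite subr_gt0.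
  by rewrite mulrBr mulr1 lerB.
exact: le_lt_trans (ler_norm _) big.
Qed.

Lemma no_cycle_small (K : fieldType) (d : nat) (c e : R) : (0 < d)%N -> 0 < c ->
  c < d.+1%:R -> d.+1%:R < g_fun d c -> 0 < e -> exists N, forall n, (N <= n)%N ->
  expect R _ (face_prob R n d (c / n%:R)) (fun F => (nullity R n K F <= 0)%R%:R) < e.
Proof.
move=> d0 c0 cd gc e0; have d0R : 0 < d.+1%:R :> R by rewrite ltr0n.
(* [h n] is [nullity_bound] divided by C(n, d); its limit [l] equals (g_d(c) - (d+1))/(d+1). *)
pose h (n : nat) : R := (n - d)%:R * (c / n%:R) / d.+1%:R *
    (1 - (1 - c / n%:R) ^+ (n - d.+1)) ^+ d.+1 -
  (1 - (1 - c / n%:R) ^+ (n - d) - (n - d)%:R * (c / n%:R) * (1 - c / n%:R) ^+ (n - d.+1)).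
pose l := c / d.+1%:R * (1 - exp (- c)) ^+ d.+1 - (1 - exp (- c) - c * exp (- c)).
have hl : Un_cv h l.
  have p1 := cv_pow_exp c d.+1 c0; have p2 := cv_pow_exp c d c0; have p3 := cv_mean c d.
  apply: cvB; [apply: cvM; [|apply: cvX; apply: cvB] | apply: cvB; [apply: cvB|apply: cvM]] => //;
    try exact: cv_const.
  by apply: cvM => //; exact: cv_const.
have l0 : 0 < l.
  rewrite -(pmulr_rgt0 _ d0R).
  have -> : d.+1%:R * l = g_fun d c - d.+1%:R.
    rewrite g_funE /l; field; by rewrite addrC natr1 gt_eqF.
  by rewrite subr_gt0.
have l20 : 0 < l / 2%:R by rewrite divr_gt0 // ltr0n.
have [N1 hN1] := (Un_cvP _ _).1 hl _ l20.
have [N2 hN2] := bin_large d (`|c / d.+1%:R / (l / 2%:R) ^+ 2 / e|) d0.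
exists (N1 + N2 + d.+1)%N => n /geq_sum3[N1n N2n dn].
have [_ big] := hN2 n N2n.
have p01 : 0 <= c / n%:R <= 1 by apply: (edge_prob01 n c d.+1).
have b0 : 0 < 'C(n, d)%:R :> R by apply: le_lt_trans big.
have hn : l / 2%:R <= h n.
  have := hN1 n N1n.
  rewrite ltr_norml => /andP[+ _]; have : l = l / 2%:R + l / 2%:R by field.
  lra.
have bE : nullity_bound R n d (c / n%:R) = 'C(n, d)%:R * h n.
  rewrite /nullity_bound /h -subnS mulrA binS_prob; ring.
have bn : 'C(n, d)%:R * (l / 2%:R) <= nullity_bound R n d (c / n%:R).
  by rewrite bE ler_wpM2l // ltW.
apply: le_lt_trans (no_cycle_prob R n d _ p01 K _) _.
  by apply: lt_le_trans bn; rewrite mulr_gt0.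
apply: (ratio_small _ _ (c / d.+1%:R) (l / 2%:R) 'C(n, d)%:R) => //.
  exact: binS_prob_le (leq_trans (ltn0Sn d) dn).
exact: le_lt_trans (ler_norm _) big.
Qed.

Lemma square_lt_pow (c e : R) : 1 < c -> 0 < e ->
  exists k, 4%:R * (k.+3 ^ 2)%:R < e * c ^+ k.+3.
Proof.
move=> c1 e0; set x := c - 1; have x0 : 0 < x by rewrite subr_gt0.
have growth j : 1 + j%:R * x <= c ^+ j.
  elim: j => [|j IH]; first by rewrite mul0r addr0 expr0.
  have c0 : 0 <= c by apply: le_trans (ltW c1).
  rewrite exprS; apply: le_trans (ler_wpM2l c0 IH); rewrite -subr_ge0.
  have -> : c * (1 + j%:R * x) - (1 + j.+1%:R * x) = j%:R * (x * x).
    by rewrite -natr1 /x; ring.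
  by rewrite mulr_ge0 ?ler0n // mulr_ge0 ?ltW.
(* With k + 3 = 4j, c^(4j) >= (jx)^4 by Bernoulli's inequality, so 64 j^2 < e x^4 j^4 suffices; it
   holds when j >= 1 and j > B. *)
pose B := 64%:R / (e * x ^+ 4); pose j := (Num.bound B).+1.
have ex0 : 0 < e * x ^+ 4 by rewrite mulr_gt0 ?exprn_gt0.
have jB : B < j%:R.
  apply: lt_le_trans (_ : (Num.bound B)%:R <= _); last by rewrite ler_nat.
  by apply: archi_boundP; rewrite divr_ge0 ?ler0n ?(ltW ex0).
have j0 : 0 < j%:R :> R by rewrite ltr0n.
exists (4 * j - 3)%N; have -> : (4 * j - 3).+3 = (4 * j)%N by lia.
have h : (j%:R * x) ^+ 4 <= c ^+ (4 * j).
  rewrite mulnC exprM lerXn2r ?nnegrE ?exprn_ge0 ?(le_trans ler01 (ltW c1)) //.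
    by rewrite mulr_ge0 ?ltW.
  by apply: le_trans (growth j); rewrite lerDr ler01.
apply: lt_le_trans (_ : e * (j%:R * x) ^+ 4 <= _); last by rewrite ler_pM2l.
rewrite natrX natrM; set y := j%:R in j0 jB *.
have -> : e * (y * x) ^+ 4 = y ^+ 2 * (y * (y * (e * x ^+ 4))) by ring.
have -> : 4%:R * (4%:R * y) ^+ 2 = y ^+ 2 * 64%:R by ring.
rewrite ltr_pM2l ?exprn_gt0 //.
rewrite ltr_pdivrMr // in jB; apply: lt_le_trans jB _.
rewrite mulrC; apply: ler_peMl; first by rewrite mulr_ge0 ?(ltW j0) ?(ltW ex0).
by rewrite /y ler1n.
Qed.

Lemma ffact_ge (n m : nat) : ((n - m) ^ m <= n ^_ m)%N.
Proof.
rewrite ffact_prod -[X in (_ ^ X <= _)%N](card_ord m) -prod_nat_const.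
apply: leq_prod => i _; apply: leq_sub2l; exact: ltnW.
Qed.

(** The length m = k + 3 is fixed first, with 4 m^2 / c^m below e. For large n the mean [M] is at
    least c^m / 2 and [P * M] is at most 2 m^2, which gives the bound. *)
Lemma no_tour_small (c e : R) : 1 < c -> 0 < e -> exists k N, forall n, (N <= n)%N ->
  expect R _ (face_prob R n 1 (c / n%:R)) (fun F => (tour_count n k R F == 0)%R%:R) < e.
Proof.
move=> c1 e0; have [k hk] := square_lt_pow c e c1 e0; exists k; set m := k.+3 in hk *.
have c0 : 0 < c by apply: lt_trans c1.
have cm0 : 0 < c ^+ m by rewrite exprn_gt0.
pose C0 : R := (2 ^ m * m ^ m)%:R * c ^+ m.
have C00 : 0 <= C0 by rewrite mulr_ge0 ?ler0n ?ltW.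
(* [A] / n collects both errors of order 1/n: the loss in the mean [M] against c^m and the partial
   overlaps. The bound [b] below ensures c/n <= 1, A/n <= 1 and m^2/n <= 1/2. *)
pose A : R := c ^+ m * (m ^ 2)%:R + C0.
have A0 : 0 <= A by rewrite addr_ge0 // mulr_ge0 ?ler0n ?ltW.
pose b := Num.bound (c + A + 2%:R * (m ^ 2)%:R).
have m20 : 0 < (m ^ 2)%:R :> R by rewrite ltr0n expn_gt0.
have m21 : 1 <= (m ^ 2)%:R :> R by rewrite ler1n expn_gt0.
have hb : c + A + 2%:R * (m ^ 2)%:R < b%:R.
  by apply: archi_boundP; move: c0 A0 m20; lra.
exists (b + m + 1)%N => n /geq_sum3[b_n mn n0].
have n0R : 0 < n%:R :> R by rewrite ltr0n.
have bn : b%:R <= n%:R :> R by rewrite ler_nat.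
have p01 : 0 <= c / n%:R <= 1.
  by apply: (edge_prob01 n c b) => //; move: hb A0 m20; lra.
have npc : n%:R * (c / n%:R) = c by rewrite mulrCA divff ?mulr1 ?gt_eqF.
have := no_tour_prob n k R _ p01 c mn (ltW c1) npc; rewrite -/m.
set P := expect _ _ _ _; set M := _ * (c / n%:R) ^+ m => main.
have {}main : P * M <= c ^+ m + (m ^ 2)%:R + C0 / n%:R - M by [].
have ME : c ^+ m * (1 - (m ^ 2)%:R / n%:R) <= M.
  have x01 : 0 <= (m%:R / n%:R : R) <= 1.
    by rewrite divr_ge0 ?ler0n //= ler_pdivrMr // mul1r ler_nat.
  have h1 := bernoulli _ m x01.
  have h2 : ((n - m)%:R) ^+ m <= (n ^_ m)%:R :> R by rewrite -natrX ler_nat ffact_ge.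
  have -> : M = c ^+ m * ((n ^_ m)%:R / n%:R ^+ m).
    by rewrite /M expr_div_n mulrCA mulrA.
  rewrite ler_pM2l //; apply: le_trans (_ : (1 - m%:R / n%:R) ^+ m <= _).
    by rewrite natrX expr2 -mulrA.
  rewrite ler_pdivlMr ?exprn_gt0 // -exprMn mulrBl mul1r divfK ?gt_eqF //.
  by rewrite -natrB.
have P0 : 0 <= P.
  rewrite -(expect_const R _ (face_prob R n 1 (c / n%:R)) 0).
  apply: expect_le => [t|F]; [exact: face_prob01 | exact: ler0n].
have small : (m ^ 2)%:R / n%:R <= 1 / 2%:R :> R.
  rewrite (ler_pdivrMr _ _ n0R).
  by move: bn hb c0 A0; lra.
have M2 : c ^+ m * (1 / 2%:R) <= M.
  by apply: le_trans ME; rewrite ler_pM2l //; move: small; lra.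
have An : A / n%:R <= 1.
  rewrite ler_pdivrMr // mul1r; apply: le_trans bn; apply: ltW; apply: le_lt_trans hb.
  by rewrite -addrA addrCA lerDl addr_ge0 ?mulr_ge0 ?ler0n ?ltW.
have AE : A / n%:R = c ^+ m * ((m ^ 2)%:R / n%:R) + C0 / n%:R.
  by rewrite /A mulrDl mulrA.
have up : P * M <= 2%:R * (m ^ 2)%:R.
  have fin (pm u v t z y : R) : u * (1 - v) <= y -> u * v + z <= 1 -> 1 <= t ->
      pm <= u + t + z - y -> pm <= 2%:R * t by lra.
  by apply: fin ME _ m21 main; rewrite -AE.
have low : P * (c ^+ m * (1 / 2%:R)) <= P * M by rewrite ler_wpM2l.
rewrite -(ltr_pM2r cm0).
have fin (u s y z : R) : u * (1 / 2%:R) <= y -> y <= 2%:R * s -> 4%:R * s < z -> u < z.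
  by lra.
by apply: fin up hk; rewrite -mulrA.
Qed.

(** * Passage to the law of the random complex and conclusion *)

Lemma weight_dfacesE (d n : nat) (p : R) (F : {set {set 'I_n}}) : dfaces n d F ->
  weight R _ (face_prob R n d p) F = p ^+ #|F| * (1 - p) ^+ ('C(n, d.+1) - #|F|).
Proof.
move=> dF; rewrite /weight (bigID (mem F)) /=; congr (_ * _).
  rewrite -prodr_const; apply: eq_bigr => t tF; rewrite tF.
  by rewrite /face_prob (forall_inP dF).
rewrite (bigID [pred t : {set 'I_n} | #|t| == d.+1]) /= [X in _ * X]big1 ?mulr1; last first.
  by move=> t /andP[/negbTE -> /negbTE td]; rewrite /face_prob td subr0.
pose D := [set t : {set 'I_n} | #|t| == d.+1].
have FD : F \subset D by apply/subsetP => t tF; rewrite inE (forall_inP dF).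
have -> : ('C(n, d.+1) - #|F| = #|D :\: F|)%N.
  by rewrite cardsD (setIidPr FD) card_draws card_ord.
rewrite -prodr_const; apply: eq_big => [t|t /andP[/negbTE -> td]]; first by rewrite !inE.
by rewrite /face_prob td.
Qed.

Lemma probYE (d n : nat) (p : R) (Ev : {set {set 'I_n}} -> Prop) :
  probY d n p Ev = \sum_(F | dfaces n d F) weight R _ (face_prob R n d p) F *
    (if excluded_middle_informative (Ev F) then 1 else 0).
Proof.
rewrite /probY; apply: eq_bigr => F dF; rewrite weight_dfacesE //.
by case: (excluded_middle_informative (Ev F)) => h /=; rewrite ?mulr1 ?mulr0 ?RpowE.
Qed.

(** A union bound over two exceptional events. These are boolean, while the event itself is a
    proposition decided classically. *)
Lemma probY_bounds (d n : nat) (p : R) (Ev : {set {set 'I_n}} -> Prop)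
    (b1 b2 : pred {set {set 'I_n}}) : 0 <= p <= 1 ->
  (forall F, dfaces n d F -> ~~ b1 F -> ~~ b2 F -> Ev F) ->
  1 - expect R _ (face_prob R n d p) (fun F => (b1 F)%:R)
    - expect R _ (face_prob R n d p) (fun F => (b2 F)%:R) <= probY d n p Ev <= 1.
Proof.
move=> p01 h; set pr := face_prob R n d p.
have pE : probY d n p Ev = expect R _ pr (fun F =>
    if excluded_middle_informative (Ev F) then 1 else 0).
  rewrite probYE /expect [RHS](bigID (dfaces n d)) /= [X in _ + X]big1 ?addr0 //.
  by move=> F dF; rewrite weight_dfaces // mul0r.
rewrite pE -{1}(expect_const R _ pr 1) -!expectB; apply/andP; split.
  apply: expect_le_dfaces => // F dF; case: (excluded_middle_informative (Ev F)) => /= [EF|nE].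
    by rewrite -addrA gerDl -opprD oppr_le0 addr_ge0 ?ler0n.
  case: (boolP (b1 F)) => B1; first by rewrite subrr sub0r oppr_le0 ler0n.
  case: (boolP (b2 F)) => B2; first by rewrite subr0 subrr.
  by case: nE; apply: h.
rewrite -[leRHS](expect_const R _ pr); apply: expect_le; first exact: face_prob01.
by move=> F; case: (excluded_middle_informative (Ev F)) => EF /=; rewrite ?ler01.
Qed.

Theorem theorem7p4 (K : fieldType) (d : nat) (cd c : R) :
  (1 <= d)%N -> is_c d cd -> Rlt cd c -> Rlt c (INR d.+1) ->
  Un_cv (fun n : nat =>
           probY d n (Rdiv c (INR n))
             (fun F => ~ WLP K n (gens_AY K n d F)))
        R1.
Proof.
move=> d0 cdP /RltP cdc /RltP; rewrite INRE => cd1.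
have c0 : 0 < c.
  apply: le_lt_trans cdc; case: cdP => [[_ ->]|[_ [/RltP h _]]]; first exact: ler01.
  exact: ltW.
have many := many_faces_small d c _ d0 c0 cd1.
(* The exceptional event may depend on [e], since for d = 1 the length of the cycles sought is
   chosen according to [e]. *)
have few (e : R) : 0 < e -> exists b2 : forall n, pred {set {set 'I_n}},
    (exists N, forall n, (N <= n)%N ->
      expect R _ (face_prob R n d (c / n%:R)) (fun F => (b2 n F)%:R) < e) /\
    forall n F, ~~ b2 n F -> has_cycle K n F.
  case: cdP => [[d1 cd1E]|cdP] e0.
    have c1 : 1 < c by rewrite cd1E in cdc.
    have [k small] := no_tour_small c e c1 e0.
    exists (fun n F => tour_count n k R F == 0); rewrite d1; split=> // n F.
    exact: tour_count_neq0_has_cycle.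
  have d1 : (1 < d)%N by case: cdP.
  have gc := g_fun_gt d cd c d1 (or_intror cdP) c0 cdc cd1.
  exists (fun n F => nullity R n K F <= 0); split; first exact: no_cycle_small.
  by move=> n F; rewrite -ltNge; apply: nullity_gt0_has_cycle.
apply/Un_cvP => e e0; have e20 : 0 < e / 2%:R by rewrite divr_gt0 ?ltr0n.
have [N1 h1] := many _ e20; have [b2 [[N2 h2] b2cyc]] := few _ e20.
exists (N1 + N2 + d.+1)%N => n /geq_sum3[N1n N2n dn]; rewrite RdivE INRE.
have p01 : 0 <= c / n%:R <= 1 by apply: (edge_prob01 n c d.+1).
have [|lo hi] := andP (probY_bounds d n (c / n%:R)
    (fun F => ~ WLP K n (gens_AY K n d F)) (fun F => 'C(n, d) <= #|F|)%N (b2 n) p01 _).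
  by move=> F dF; rewrite -ltnNge => Fn /b2cyc; apply: has_cycle_not_WLP.
rewrite ltr_norml; apply/andP; split.
  have fin (x y q : R) : 1 - x - y <= q -> x < e / 2%:R -> y < e / 2%:R -> - e < q - 1.
    by lra.
  exact: fin lo (h1 n N1n) (h2 n N2n).
by apply: le_lt_trans e0; rewrite subr_le0.
Qed.
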